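(* (Geiger–Muller counter of type 1, Poisson flow.) Let $(\tau_k)_{k\ge1}$ and $(\eta_k)_{k\ge1}$ be independent sequences, each consisting of i.i.d. random variables, with $\mathbf{P}(\tau_k<t)=1-e^{-\lambda t}$ for $t\ge0$, $\lambda>0$, and $\mathbf{P}(\eta_k<t)=G(t)$ with $G(+0)=0$. Let $\nu=\min\{k\ge1:\tau_k<\eta_k\}$, let $T=\sum_{i=1}^{\nu}\tau_i$ be the time during which the counter does not lose any particle, and let $\phi(z)=\int_0^\infty e^{-zt}\,dG(t)$. Then for all $z\ge0$ $$\mathbf{E}e^{-zT}=\frac{\lambda(1-\phi(z+\lambda))}{z+\lambda(1-\phi(z+\lambda))},$$ and $$\mathbf{E}T=\frac{1}{\lambda q},\qquad \mathbf{D}T=\frac{2(q+\lambda a_0)-1}{\lambda^2q^2},$$ where $q=1-\phi(\lambda)$ and $a_0=\lambda\int_0^\infty t e^{-\lambda t}G(t)\,dt$.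
   Context: Model: a particle reaching the counter at time $t_0=0$ is registered and locks the counter; subsequent particles arrive at times $t_1<t_2<\dots$ with $\tau_k=t_k-t_{k-1}$; the particle arriving at $t_{k-1}$ (if registered) locks the counter for a time $\eta_k$, and particles arriving while the counter is locked are lost. Thus the first lost particle is the one arriving at $t_\nu$, and $T=t_\nu$. $\mathbf{D}$ denotes variance; $G(+0)$ is the right limit of $G$ at $0$. *)

(* Defs.v *)
From HB Require Import structures.
From mathcomp Require Import all_boot all_order all_algebra.
From mathcomp Require Import all_classical all_reals all_analysis.
Set Implicit Arguments.
Unset Strict Implicit.
Unset Printing Implicit Defensive.
Import Order.TTheory GRing.Theory Num.Theory.
Import numFieldNormedType.Exports.

Local Open Scope classical_set_scope.
Local Open Scope ring_scope.

(* Sequences of random variables are numbered from 0: index k stands for the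
   (k+1)-st inter-arrival time tau_{k+1}, resp. locking time eta_{k+1}. *)
Section Independence.
Context d (Omega : measurableType d) (R : realType) (P : probability Omega R).
Implicit Types X Y : nat -> {RV P >-> R}.

Definition mutually_independent X : Prop :=
  forall (J : seq nat) (A : nat -> set R),
    uniq J -> (forall k, k \in J -> measurable (A k)) ->
    P (\bigcap_(k in [set` J]) X k @^-1` A k) =
      (\prod_(k <- J) P (X k @^-1` A k))%E.

Definition sigma_of_seq X : set (set Omega) :=
  <<s [set E | exists k (A : set R), measurable A /\ E = X k @^-1` A] >>.

Definition independent_seqs X Y : Prop :=
  forall A B, sigma_of_seq X A -> sigma_of_seq Y B ->
    P (A `&` B) = (P A * P B)%E.

End Independence.

Section Stieltjes.
Context (R : realType).
Implicit Types (G : R -> R) (x y z t : R).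

(* The measure dG of a nondecreasing G gives mass G(b + 0) - G(a + 0) to
   ]a, b], so it is the Lebesgue-Stieltjes measure of t |-> G(t + 0).  The
   passage to right limits matters because t |-> P(eta < t) is only
   left-continuous.  The value 0 for a G that is not nondecreasing is a dummy
   value, making the definition total. *)
Definition right_lim G : R -> R := fun x =>
  if `[< {homo G : s t / s <= t} >] then lim (G y @[y --> x^'+]) else 0.

Lemma cvg_right_lim G x : {homo G : s t / s <= t} ->
  G y @[y --> x^'+] --> right_lim G x.
Proof.
move=> ndG; rewrite /right_lim (asboolT ndG).
apply: nondecreasing_at_right_is_cvgr; near=> b.
  by move=> u v _ _; exact: ndG.
exists (G x) => _ [y /= + <-].
by rewrite in_itv/= => /andP[/ltW xy _]; exact: ndG.
Unshelve. all: by end_near. Qed.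

Lemma ge_right_lim G x : {homo G : s t / s <= t} -> G x <= right_lim G x.
Proof.
move=> ndG; have := cvg_right_lim (x := x) ndG => /[dup] /cvgP cv cl.
rewrite -(cvg_lim _ cl)//; apply: limr_ge => //.
by near=> y; apply: ndG; apply: ltW; near: y; exact: nbhs_right_gt.
Unshelve. all: by end_near. Qed.

Lemma le_right_lim G x y : {homo G : s t / s <= t} -> x < y ->
  right_lim G x <= G y.
Proof.
move=> ndG xy; have := cvg_right_lim (x := x) ndG => /[dup] /cvgP cv cl.
rewrite -(cvg_lim _ cl)//; apply: limr_le => //.
near=> t; apply: ndG; apply: ltW; near: t; exact: nbhs_right_lt.
Unshelve. all: by end_near. Qed.

Lemma right_lim_nondecreasing G : nondecreasing (right_lim G).
Proof.
move=> x y; rewrite le_eqVlt => /predU1P[->//|xy].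
have [ndG|ndG] := pselect {homo G : s t / s <= t}.
  exact: le_trans (le_right_lim ndG xy) (ge_right_lim _ ndG).
by rewrite /right_lim (asboolF ndG).
Qed.

Lemma right_lim_right_continuous G : right_continuous (right_lim G).
Proof.
move=> x.
have [ndG|ndG] := pselect {homo G : s t / s <= t}; last first.
  have -> : right_lim G = cst 0.
    by apply/funext => y; rewrite /right_lim (asboolF ndG).
  exact: cvg_cst.
apply/cvgrPdist_le => e e0.
have /cvgrPdist_le/(_ e e0) Hx := cvg_right_lim (x := x) ndG.
have [b [xb Hb]] : exists b, x < b /\ `|right_lim G x - G b| <= e.
  near x^'+ => b; exists b; split; near: b; first exact: nbhs_right_gt.
  exact: Hx.
near=> y.
have xy : x < y by near: y; exact: nbhs_right_gt.
have yb : y < b by near: y; exact: nbhs_right_lt.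
have h1 := right_lim_nondecreasing G (ltW xy).
have h2 := le_right_lim ndG yb.
rewrite distrC ger0_norm ?subr_ge0//.
apply: le_trans Hb; rewrite distrC ger0_norm ?subr_ge0 ?lerB//.
exact: le_trans h2.
Unshelve. all: by end_near. Qed.

HB.instance Definition _ G := isCumulative.Build R _ R (right_lim G)
  (@right_lim_nondecreasing G) (@right_lim_right_continuous G).

Definition stieltjes G := lebesgue_stieltjes_measure (right_lim G).

Definition laplace_stieltjes G z : R :=
  \int[stieltjes G]_(t in `[0, +oo[) expR (- (z * t)).

End Stieltjes.

Section Counter.
Context (Omega : Type) (R : realType).
Variables tau eta : nat -> Omega -> R.
Local Open Scope ereal_scope.

(* [None] when no particle is ever lost; with the numbering from 0,
   [Some n] means that the first lost particle is the one arriving at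
   t_{n+1}. *)
Definition first_loss (w : Omega) : option nat :=
  match pselect (exists k, (tau k w < eta k w)%R) with
  | left ex => Some (ex_minn ex)
  | right _ => None
  end.

Definition lossless_time (w : Omega) : \bar R :=
  if first_loss w is Some n then (\sum_(i < n.+1) tau i w)%R%:E else +oo.

End Counter.

(* The library's expectation and variance only take real-valued functions,
   but [lossless_time] may be infinite. *)
Section Moments.
Context d (Omega : measurableType d) (R : realType) (P : probability Omega R).
Local Open Scope ereal_scope.

Definition mean (X : Omega -> \bar R) : \bar R := \int[P]_w X w.

Definition var (X : Omega -> \bar R) : \bar R :=
  mean (fun w => (X w - mean X) ^+ 2).

End Moments.

(* Main.v *)
Require Import Defs.
From HB Require Import structures.
From mathcomp Require Import all_boot all_order all_algebra.
From mathcomp Require Import all_classical all_reals all_analysis.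
From mathcomp Require Import measurable_realfun lra ring.
Set Implicit Arguments.
Unset Strict Implicit.
Unset Printing Implicit Defensive.
Import Order.TTheory GRing.Theory Num.Theory.
Import numFieldNormedType.Exports.

Local Open Scope classical_set_scope.
Local Open Scope ring_scope.

(** The proof computes the Laplace transform of T and reads both moments off it.

    Let W_n = (tau_n, eta_n).  A particle is kept when tau_n >= eta_n and lost
    when tau_n < eta_n, so on the event that the first loss occurs at n,
    e^(-z T) is the product of the factors e^(-z tau_k) 1(tau_k >= eta_k) for
    k < n and of e^(-z tau_n) 1(tau_n < eta_n); for z > 0 both sides vanish when
    nothing is ever lost ([discounted_lossless_time]).  The pair W_n is
    independent of the preceding ones ([history_indep]), so the expectations of
    these products are A^n B, where A and B are the expectations of the two
    kinds of factors, and E e^(-z T) = B / (1 - A) ([laplace_lossless_time]).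
    The identity
    E[e^(-z tau); tau >= y] = lambda / (lambda + z) e^(-(z + lambda) y)
    ([integral_race]), integrated over the law of eta, gives
    A = lambda / (lambda + z) phi(z + lambda) ([integral_kept_discount]) and
    A + B = lambda / (lambda + z).  Here phi is an expectation because dG is
    the law of eta ([stieltjes_law]).

    For the moments, write L for the transform and
    D(z) = z + lambda (1 - phi(z + lambda)), so that 1 - L(z) = z / D(z).  As z
    runs through the powers 2^(-n), (1 - e^(-z T)) / z increases to T.
    Monotone convergence, applied to this quotient and to its square
    ([mean_limit], [mean_square_limit]), shows that E T and E T^2 are the limits
    of 1 / D(z) and of 2 (D(2z) - D(z)) / (z D(z) D(2z)).  The continuity of
    phi at lambda ([cvg_laplace]) and the limit E[eta e^(-lambda eta)] of
    (phi(z + lambda) - phi(2z + lambda)) / z ([cvg_laplace_quotient]) are enough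
    to compute them.  Finally, a_0 enters through the identity
    lambda a_0 = lambda E[eta e^(-lambda eta)] + phi(lambda), a consequence of
    Tonelli's theorem ([expectation_tail_G], [expectation_mul_expRN]). *)

(** * Independence *)

Section PairLaw.
Local Open Scope ereal_scope.
Context d d1 d2 (Omega : measurableType d) (T1 : measurableType d1)
  (T2 : measurableType d2) (R : realType) (P : probability Omega R).

Definition pair_rv (X : {mfun Omega >-> T1}) (Y : {mfun Omega >-> T2})
  (w : Omega) :=
  (X w, Y w).

Lemma measurable_pair_rv X Y : measurable_fun setT (pair_rv X Y).
Proof. exact: measurable_fun_pair. Qed.

HB.instance Definition _ X Y :=
  isMeasurableFun.Build _ _ _ _ (pair_rv X Y) (measurable_pair_rv X Y).

Variables (X : {mfun Omega >-> T1}) (Y : {mfun Omega >-> T2}).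

(** Both sides are finite measures in D, and rectangles form a pi-system that
    generates the product sigma-algebra. *)
Lemma indep_event_pair (F : set Omega) : measurable F ->
  (forall A B, measurable A -> measurable B ->
    P (F `&` (X @^-1` A `&` Y @^-1` B)) = P F * P (X @^-1` A `&` Y @^-1` B)) ->
  forall D, measurable D ->
    P (F `&` pair_rv X Y @^-1` D) = P F * P (pair_rv X Y @^-1` D).
Proof.
move=> mF FXY D mD.
have PF0 : (0 <= fine (P F))%R by exact: fine_ge0.
pose m0 : {measure set (T1 * T2) -> \bar R} :=
  pushforward (mrestr P mF) (pair_rv X Y).
pose m1 := m0 (measurable_pair_rv X Y).
pose m2 : {measure set (T1 * T2) -> \bar R} :=
  mscale (NngNum PF0) (distribution P (pair_rv X Y)).
pose C : set (set (T1 * T2)) :=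
  [set C | exists A, measurable A /\ exists B, measurable B /\ C = A `*` B].
suff : m1 D = m2 D.
  rewrite /m1/= /pushforward/= /mrestr setIC => ->.
  by rewrite /m2 /= /mscale /= fineK ?fin_num_measure.
apply: (measure_unique C (fun=> setT)) => //.
- rewrite measurable_prod_measurableType; congr (<<s _ >>).
  rewrite predeqE; split => [[A mA [B mB <-]]|[A [mA [B [mB ->]]]]].
    by exists A; split => //; exists B.
  by exists A => //; exists B.
- move=> /= _ _ [X1 [mX1 [X2 [mX2 ->]]]] [Y1 [mY1 [Y2 [mY2 ->]]]].
  rewrite -setXI; exists (X1 `&` Y1); split; first exact: measurableI.
  by exists (X2 `&` Y2); split => //; exact: measurableI.
- by move=> n; exists setT; split => //; exists setT; rewrite setXTT.
- by rewrite bigcup_const//; exists 0%N.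
- move=> _ [A [mA [B [mB ->]]]].
  rewrite /m1/= /pushforward/= /mrestr setIC.
  rewrite /m2 /= /mscale /= fineK ?fin_num_measure//.
  exact: FXY.
- move=> k; rewrite /m1/= /pushforward/= /mrestr preimage_setT setTI.
  by rewrite (le_lt_trans (probability_le1 _ _)) ?ltry.
Qed.

(** Independence makes the joint law a product, so this is Tonelli's theorem;
    keeping both integrals over Omega avoids mentioning the laws. *)
Lemma integral_indep_pair (f : T1 * T2 -> \bar R) :
  (forall A B, measurable A -> measurable B ->
    P (X @^-1` A `&` Y @^-1` B) = P (X @^-1` A) * P (Y @^-1` B)) ->
  measurable_fun [set: T1 * T2] f -> (forall x, 0 <= f x) ->
  \int[P]_w f (X w, Y w) = \int[P]_w \int[P]_v f (X v, Y w).
Proof.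
move=> XY mf f0.
rewrite (_ : \int[P]_w f (X w, Y w) = \int[distribution P (pair_rv X Y)]_z f z);
  last first.
  by rewrite ge0_integral_distribution.
rewrite (eq_measure_integral (distribution P X \x distribution P Y)%E);
  last first.
  move=> D mD _; apply/esym; apply: product_measure_unique => //.
rewrite fubini_tonelli2//= ge0_integral_distribution//=.
- apply: eq_integral => w _ /=; rewrite /fubini_G/=.
  rewrite ge0_integral_distribution//=.
  exact: measurableT_comp.
- exact: measurable_fun_fubini_tonelli_G.
- by move=> y; apply: integral_ge0.
Qed.

End PairLaw.

Lemma integral_cst_probability d (Omega : measurableType d) (R : realType)
  (P : probability Omega R) (r : R) : (\int[P]_w r%:E = r%:E)%E.
Proof.
by rewrite integral_cst//; have /= -> := @probability_setT _ _ _ P;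
  rewrite mule1.
Qed.

Section History.
Context d dT (Omega : measurableType d) (T : measurableType dT) (R : realType)
  (P : probability Omega R) (tau eta : nat -> {RV P >-> R}).
Variables (step : {mfun (T * (R * R))%type >-> T}) (x0 : T).

(** A state driven by the successive pairs (tau_k, eta_k): its value at n
    depends on the pairs of index k < n only. *)
Fixpoint history (n : nat) (w : Omega) : T :=
  if n is k.+1 then step (history k w, (tau k w, eta k w)) else x0.

Lemma measurable_history n : measurable_fun setT (history n).
Proof.
elim: n => [|n IH]; first exact: measurable_cst.
apply: (measurableT_comp (f := step)) => //.
by apply: measurable_fun_pair => //; exact: measurable_fun_pair.
Qed.

HB.instance Definition _ n :=
  isMeasurableFun.Build _ _ _ _ (history n) (measurable_history n).

Let W k := pair_rv (tau k) (eta k).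

(** The event that tau_k lies in A_k and eta_k in B_k for every k in J.  The
    independence hypotheses bear on such events. *)
Definition box (J : seq nat) (A B : nat -> set R) : set Omega :=
  (\bigcap_(k in [set` J]) tau k @^-1` A k) `&`
  (\bigcap_(k in [set` J]) eta k @^-1` B k).

Local Lemma measurable_bigcap_preimage (X : nat -> {RV P >-> R}) (J : seq nat)
  (A : nat -> set R) :
  (forall k, measurable (A k)) ->
    measurable (\bigcap_(k in [set` J]) X k @^-1` A k).
Proof.
move=> mA; rewrite bigcap_seq; elim/big_ind: _ => //; first exact: measurableI.
by move=> k _; exact: measurable_funPTI.
Qed.

Lemma measurable_box J A B : (forall k, measurable (A k)) ->
  (forall k, measurable (B k)) -> measurable (box J A B).
Proof.
by move=> mA mB; apply: measurableI; exact: measurable_bigcap_preimage.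
Qed.

(** This is the form in which the independence of the two sequences applies to
    a box. *)
Lemma sigma_of_seq_bigcap (X : nat -> {RV P >-> R}) (J : seq nat)
  (A : nat -> set R) :
  (forall k, measurable (A k)) ->
  sigma_of_seq X (\bigcap_(k in [set` J]) X k @^-1` A k).
Proof.
move=> mA; rewrite /sigma_of_seq.
pose G := [set E | exists k (B : set R), measurable B /\ E = X k @^-1` B].
pose GT := g_sigma_algebraType G.
rewrite bigcap_seq; elim/big_ind: _.
- exact: (@measurableT _ GT).
- by move=> E F; exact: (@measurableI _ GT).
- by move=> k _; apply: sub_sigma_algebra; exists k, (A k).
Qed.

Hypotheses (tau_indep : mutually_independent tau)
  (eta_indep : mutually_independent eta)
    (tau_eta_indep : independent_seqs tau eta).

Lemma probability_box J A B : uniq J -> (forall k, measurable (A k)) ->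
  (forall k, measurable (B k)) ->
  P (box J A B) =
    (\prod_(k <- J) (P (tau k @^-1` A k) * P (eta k @^-1` B k)))%E.
Proof.
move=> uJ mA mB; rewrite /box tau_eta_indep; last 2 first.
- exact: sigma_of_seq_bigcap.
- exact: sigma_of_seq_bigcap.
by rewrite tau_indep// eta_indep// big_split.
Qed.

Lemma probability_pair k (A B : set R) : measurable A -> measurable B ->
  P (tau k @^-1` A `&` eta k @^-1` B) =
    (P (tau k @^-1` A) * P (eta k @^-1` B))%E.
Proof.
move=> mA mB; have := @probability_box [:: k] (fun=> A) (fun=> B) isT.
by rewrite /box set_cons1 !bigcap_set1 big_seq1; exact.
Qed.

(** Induction on n.  The state at n.+1 is a function of the state at n and of
    W n, and a rectangle in W n only adds the index n to the box, so that two
    passes from rectangles to arbitrary events ([indep_event_pair]), first for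
    W n, then for the pair formed with the state, give the next step.  For
    this the box has to range over all families of later indices. *)
Let history_box n : forall J A B C, uniq J ->
  (forall k, k \in J -> (n <= k)%N) ->
  (forall k, measurable (A k)) -> (forall k, measurable (B k)) ->
    measurable C ->
  P (box J A B `&` history n @^-1` C) =
    (P (box J A B) * P (history n @^-1` C))%E.
Proof.
elim: n => [|n IH].
  move=> J A B C uJ Jn mA mB mC; have [Cx0|Cx0] := pselect (C x0).
    rewrite (_ : history 0 @^-1` C = setT);
      first by rewrite setIT probability_setT mule1.
    by apply/seteqP; split.
  rewrite (_ : history 0 @^-1` C = set0); first by rewrite setI0 measure0 mule0.
  by apply/seteqP; split.
have mh K : measurable K -> measurable (history n @^-1` K).
  by move=> mK; exact: measurable_funPTI.
(* A box, a state and a rectangle in W n amount to a state and a larger box. *)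
have boxW J A B K D : uniq J -> (forall k, k \in J -> (n < k)%N) ->
    (forall k, measurable (A k)) -> (forall k, measurable (B k)) ->
    measurable K -> measurable D ->
    P (box J A B `&` history n @^-1` K `&` W n @^-1` D) =
    (P (box J A B `&` history n @^-1` K) * P (W n @^-1` D))%E.
  move=> uJ Jn mA mB mK mD; apply: indep_event_pair => //.
    by apply: measurableI; [exact: measurable_box|exact: mh].
  move=> F G mF mG.
  have nJ : n \notin J by apply/negP => /Jn; rewrite ltnn.
  have neq k : k \in J -> (k == n) = false.
    by move=> kJ; apply/eqP => kn; rewrite -kn kJ in nJ.
  have Jn' k : k \in n :: J -> (n <= k)%N.
    by rewrite inE => /predU1P[->//|/Jn /ltnW].
  pose A' k := if k == n then F else A k.
  pose B' k := if k == n then G else B k.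
  have mA' k : measurable (A' k) by rewrite /A'; case: ifP.
  have mB' k : measurable (B' k) by rewrite /B'; case: ifP.
  have boxE : box (n :: J) A' B' =
      box J A B `&` (tau n @^-1` F `&` eta n @^-1` G).
    rewrite /box !bigcap_seq !big_cons /A' /B' eqxx.
    have eqJ (X : nat -> {RV P >-> R}) (H : set R) (E : nat -> set R) :
        \big[setI/setT]_(j <- J) (X j @^-1` (if j == n then H else E j)) =
        \big[setI/setT]_(j <- J) (X j @^-1` E j).
      by rewrite !big_seq; apply: eq_bigr => j jJ; rewrite neq.
    by rewrite !eqJ setIACA setIC.
  have PboxE : P (box (n :: J) A' B') =
      (P (box J A B) * P (tau n @^-1` F `&` eta n @^-1` G))%E.
    rewrite probability_box//=; last by rewrite nJ.
    rewrite big_cons /A' /B' eqxx muleC probability_pair// probability_box//.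
    by congr (_ * _)%E; rewrite !big_seq; apply: eq_bigr => j jJ; rewrite neq.
  rewrite setIAC -boxE IH//; last by rewrite /= nJ.
  rewrite PboxE IH// => [|k kJ]; last by rewrite ltnW// Jn.
  by rewrite -!muleA; congr (_ * _)%E; rewrite muleC.
move=> J A B C uJ Jn mA mB mC.
have hW K D : measurable K -> measurable D ->
    P (history n @^-1` K `&` W n @^-1` D) =
    (P (history n @^-1` K) * P (W n @^-1` D))%E.
  move=> mK mD; have := @boxW [::] (fun=> setT) (fun=> setT) K D isT.
  by rewrite /box set_nil !bigcap_set0 !setTI; exact.
have mD : measurable (step @^-1` C) by exact: measurable_funPTI.
rewrite -[history n.+1 @^-1` C]/(
  pair_rv (history n) (W n) @^-1` (step @^-1` C)).
apply: indep_event_pair => //; first exact: measurable_box.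
move=> K D mK mD'; rewrite setIA boxW// IH// => [|k kJ].
  by rewrite hW// muleA.
by rewrite ltnW// Jn.
Qed.

Lemma history_indep n C D : measurable C -> measurable D ->
  P (history n @^-1` C `&` W n @^-1` D) =
  (P (history n @^-1` C) * P (W n @^-1` D))%E.
Proof.
move=> mC mD; apply: indep_event_pair => //; first exact: measurable_funPTI.
move=> F G mF mG; rewrite setIC muleC.
have := @history_box n [:: n] (fun=> F) (fun=> G) C isT.
rewrite /box set_cons1 !bigcap_set1; apply => // k.
by rewrite inE => /eqP ->.
Qed.

End History.

(** * Exponential tails *)

Section Tails.
Context (R : realType).
Local Notation leb := (@lebesgue_measure R).

Lemma ge0_integral_tail (f F : R -> R) a :
  (forall x, a <= x -> 0 <= f x) -> (forall x, is_derive x (1 : R) F (f x)) ->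
  continuous f -> F x @[x --> +oo] --> 0 ->
  (\int[leb]_(x in `]a, +oo[) (f x)%:E = (- F a)%:E)%E.
Proof.
move=> f0 dF cf F0.
rewrite integral_itv_obnd_cbnd; last first.
  by apply/measurable_EFinP; apply: measurable_funTS;
    exact: continuous_measurable_fun.
rewrite (@ge0_continuous_FTC2y R f F a 0) ?add0e//.
- exact: continuous_subspaceT.
- apply/cvg_at_right_filter.
  apply: differentiable_continuous; apply/derivable1_diffP.
  by have [] := dF a.
- by move=> x _; rewrite derive1E; have [_ ->] := dF x.
Qed.

Lemma continuous_expRN (c : R) : continuous (fun t : R => expR (- (c * t))).
Proof.
move=> x; apply: differentiable_continuous; apply/derivable1_diffP.
exact: ex_derive.
Qed.

Lemma measurable_expRN (c : R) : measurable_fun setT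
  (fun x : R => expR (- (c * x))).
Proof. by apply: continuous_measurable_fun; exact: continuous_expRN. Qed.

Lemma cvgr_expRN (c : R) : 0 < c -> expR (- (c * t)) @[t --> +oo] --> (0 : R).
Proof.
move=> c0; apply:
  (@cvg_comp _ _ _ (fun t => c * t) (fun t => expR (- t)) _ (pinfty_nbhs R)).
  exact: gt0_cvgMry.
exact: cvgr_expR.
Qed.

Lemma ltr_expRN (x : R) : x * expR (- x) < 1.
Proof.
rewrite expRN ltr_pdivrMr ?expR_gt0// mul1r.
by rewrite (lt_le_trans _ (expR_ge1Dx x))// ltrDr.
Qed.

(** The factor t is absorbed by half of the exponent, since x e^(-x) < 1. *)
Lemma cvgr_mul_expRN (c : R) : 0 < c ->
  t * expR (- (c * t)) @[t --> +oo] --> (0 : R).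
Proof.
move=> c0.
have c20 : 0 < c / 2 by rewrite divr_gt0.
apply: (@squeeze_cvgr _ _ _ _ (fun=> 0)
  (fun t => (c / 2)^-1 * expR (- (c / 2 * t)))).
- near=> t; have t0 : 0 <= t by near: t; exact: nbhs_pinfty_ge.
  rewrite mulr_ge0 ?expR_ge0//=.
  rewrite ler_pdivlMl//.
  have -> : expR (- (c * t)) = expR (- (c / 2 * t)) * expR (- (c / 2 * t)).
    by rewrite -expRD; congr expR; field.
  rewrite !mulrA -[leRHS]mul1r ler_wpM2r ?expR_ge0//.
  by rewrite ltW// ltr_expRN.
- exact: cvg_cst.
- rewrite -[X in _ --> X](mulr0 (c / 2)^-1); apply: cvgM; first exact: cvg_cst.
  exact: cvgr_expRN.
Unshelve. all: by end_near. Qed.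

Lemma integral_expRN_tail (c a : R) : 0 < c ->
  (\int[leb]_(t in `]a, +oo[) (c * expR (- (c * t)))%:E =
    (expR (- (c * a)))%:E)%E.
Proof.
move=> c0; rewrite -[in RHS](opprK (expR _)).
apply: (@ge0_integral_tail _ (fun t => - expR (- (c * t)))).
- by move=> x _; rewrite mulr_ge0 ?expR_ge0// ltW.
- move=> x; apply: is_derive_eq.
  by rewrite /GRing.scale/=; ring.
- move=> x; apply: cvgM; first exact: cvg_cst.
  exact: continuous_expRN.
- by rewrite -[X in _ --> X]oppr0; apply: cvgN; exact: cvgr_expRN.
Qed.

Lemma integral_mul_expRN_tail (c a : R) : 0 < c -> 0 <= a ->
  (\int[leb]_(t in `]a, +oo[) (t * expR (- (c * t)))%:E =
   ((a + c^-1) * expR (- (c * a)) / c)%:E)%E.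
Proof.
move=> c0 a0; have cN0 : c != 0 by rewrite gt_eqF.
rewrite -[in RHS](opprK (_ / c)).
apply: (@ge0_integral_tail _ (fun t => - ((t + c^-1) * expR (- (c * t)) / c))).
- by move=> x ax; rewrite mulr_ge0 ?expR_ge0// (le_trans a0).
- move=> x; apply: is_derive_eq.
  by rewrite /GRing.scale/=; field.
- by move=> x; apply: cvgM; [exact: cvg_id|exact: continuous_expRN].
- rewrite -[X in _ --> X]oppr0 -[X in - X](mul0r c^-1); apply: cvgN.
  apply: cvgM; last exact: cvg_cst.
  rewrite (_ : (fun t => _) =
    (fun t => t * expR (- (c * t)) + c^-1 * expR (- (c * t)))); last first.
    by apply/funext => t; rewrite mulrDl.
  rewrite -[X in _ --> X]addr0; apply: cvgD; first exact: cvgr_mul_expRN.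
  rewrite -[X in _ --> X](mulr0 c^-1); apply: cvgM; first exact: cvg_cst.
  exact: cvgr_expRN.
Qed.

(** For a >= 0 and independent exponential times Z and X of rates c and l, this
    is the probability that a <= X < Z, computed by conditioning on Z. *)
Lemma integral_race_tail (c l a : R) : 0 < c -> 0 < l ->
  (\int[leb]_(t in `]a, +oo[)
     (c * expR (- (c * t)) * (expR (- (l * a)) - expR (- (l * t))))%:E =
   (l / (l + c) * expR (- ((c + l) * a)))%:E)%E.
Proof.
move=> c0 l0; have lcN0 : l + c != 0 by rewrite gt_eqF// addr_gt0.
have expcl x : expR (- ((c + l) * x)) = expR (- (l * x)) * expR (- (c * x)).
  by rewrite -expRD; congr expR; ring.
transitivity (- (c / (l + c) * expR (- ((c + l) * a))
  - expR (- (l * a)) * expR (- (c * a))))%:E; last first.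
  congr EFin; rewrite expcl.
  by field.
apply: (@ge0_integral_tail _ (fun t => c / (l + c) * expR (- ((c + l) * t))
  - expR (- (l * a)) * expR (- (c * t)))).
- move=> x ax; rewrite mulr_ge0//; first by rewrite mulr_ge0 ?expR_ge0// ltW.
  by rewrite subr_ge0 ler_expR lerN2 ler_pM2l.
- move=> x; apply: is_derive_eq.
  rewrite /GRing.scale/= expcl.
  by field.
- move=> x; apply: cvgM.
    by apply: cvgM; [exact: cvg_cst|exact: continuous_expRN].
  by apply: cvgB; [exact: cvg_cst|exact: continuous_expRN].
- rewrite -[X in _ --> X]subr0; apply: cvgB.
    rewrite -[X in _ --> X](mulr0 (c / (l + c))); apply: cvgM;
      first exact: cvg_cst.
    by apply: cvgr_expRN; exact: addr_gt0.
  rewrite -[X in _ --> X](mulr0 (expR (- (l * a)))); apply: cvgM;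
    first exact: cvg_cst.
  exact: cvgr_expRN.
Qed.

End Tails.

Section Tonelli.
Context d (Omega : measurableType d) (R : realType) (P : probability Omega R).
Local Notation leb := (@lebesgue_measure R).

(** Tonelli's theorem on the region X w < t.  It trades the tail integral of h
    beyond X for the distribution function of X, and serves both for the
    exponential law (with h the exponential density of rate z) and for a_0. *)
Lemma integral_tail_tonelli (X : {RV P >-> R}) (p : R -> bool) (h : R -> R) :
  measurable_fun setT p -> measurable_fun setT h ->
  (forall x t, p x -> x < t -> 0 <= h t) ->
  (\int[P]_w (if p (X w) then \int[leb]_(t in `]X w, +oo[) (h t)%:E else 0) =
   \int[leb]_t ((h t)%:E * P [set w | p (X w) && (X w < t)%R]))%E.
Proof.
move=> mp mh h0.
pose f (z : Omega * R) : \bar R :=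
  (if p (X z.1) && (X z.1 < z.2)%R then (h z.2)%:E else 0)%E.
have mX1 : measurable_fun setT (fun z : Omega * R => X z.1).
  exact: measurableT_comp.
have mf : measurable_fun setT f.
  apply: measurable_fun_ifT => //.
    apply: measurable_and; first exact: measurableT_comp.
    by apply: measurable_fun_ltr => //; exact: measurable_snd.
  by apply/measurable_EFinP; apply: measurableT_comp => //;
    exact: measurable_snd.
have f0 z : (0 <= f z)%E.
  by rewrite /f; case: ifP => // /andP[pz xz]; rewrite lee_fin (h0 _ _ pz).
have := @fubini_tonelli _ _ _ _ _ P leb f mf f0 => E.
transitivity (\int[P]_x \int[leb]_y f (x, y))%E.
  apply: eq_integral => w _; rewrite /f/=; case: ifPn => pX /=.
    rewrite integral_mkcond; apply: eq_integral => t _.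
    by rewrite patchE/= mem_setE/= in_itv/= andbT.
  by rewrite integral0.
rewrite E; apply: eq_integral => t _.
have mE : measurable [set w | p (X w) && (X w < t)%R].
  have : measurable_fun setT (fun w => p (X w) && (X w < t)%R).
    apply: measurable_and; first exact: measurableT_comp.
    exact: measurable_fun_ltr.
  by move=> /(_ measurableT [set true] I); rewrite setTI.
rewrite -integral_cst//; rewrite [RHS]integral_mkcond;
  apply: eq_integral => w _.
by rewrite patchE/= /f/= mem_setE.
Qed.

End Tonelli.

(** * The law of the locking times *)

Section StieltjesLaw.
Context d (Omega : measurableType d) (R : realType) (P : probability Omega R).
Variables (X : {RV P >-> R}) (G : R -> R).
Hypothesis XG : forall t : R, P [set w | X w < t] = (G t)%:E.

Lemma law_nondecreasing : {homo G : s t / s <= t}.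
Proof.
move=> s t st; rewrite -lee_fin -!XG; apply: le_measure.
- by rewrite inE; have := measurable_funPTI X (measurable_itv `]-oo, s[).
- by rewrite inE; have := measurable_funPTI X (measurable_itv `]-oo, t[).
- by move=> w /= /lt_le_trans; exact.
Qed.

(** For y > x, P(X < y) lies between P(X <= x) and P(X <= y), and the latter is
    right-continuous. *)
Lemma right_lim_cdf x : (right_lim G x)%:E = cdf X x.
Proof.
have GX : (G y)%:E @[y --> x^'+] --> cdf X x.
  apply: (@squeeze_cvge _ _ _ _ (fun=> cdf X x) _ (cdf X)).
  - near=> y; rewrite -XG /cdf /distribution/= /pushforward.
    apply/andP; split; apply: le_measure.
    + by rewrite inE; exact: measurable_funPTI.
    + by rewrite inE; have := measurable_funPTI X (measurable_itv `]-oo, y[).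
    + move=> w /=; rewrite in_itv/= => /le_lt_trans; apply.
      by near: y; exact: nbhs_right_gt.
    + by rewrite inE; have := measurable_funPTI X (measurable_itv `]-oo, y[).
    + by rewrite inE; exact: measurable_funPTI.
    + by move=> w /= /ltW; rewrite in_itv.
  - exact: cvg_cst.
  - exact: cdf_right_continuous.
have GE : (G y)%:E @[y --> x^'+] --> (right_lim G x)%:E.
  apply: cvg_EFin; first exact: nearW.
  exact: cvg_right_lim law_nondecreasing.
by rewrite (cvg_unique _ GE GX).
Unshelve. all: by end_near. Qed.

(* The Stieltjes measure lives on a copy of R with the same sigma-algebra but
   another display, so X has to be viewed as a map into that copy. *)
Let X' : Omega -> measurableTypeR R := X.

Let measurable_X' : measurable_fun setT X'.
Proof. exact: (measurable_funPT X). Qed.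

#[local] HB.instance Definition _ :=
  isMeasurableFun.Build _ _ _ _ X' measurable_X'.

(** Both measures give the mass P(X <= b) - P(X <= a) to ]a, b]. *)
Lemma stieltjes_law (A : set R) : measurable A -> stieltjes G A = P (X @^-1` A).
Proof.
move=> mA; pose mX : {measure set (measurableTypeR R) -> \bar R} :=
  distribution P X'.
suff : forall B, measurable B -> stieltjes G B = mX B by exact.
apply: lebesgue_stieltjes_measure_unique => I [[a b]]/= _ <-.
rewrite /lebesgue_stieltjes_measure /measure_extension/=.
rewrite measurable_mu_extE/=; last exact: is_ocitv.
have [ab|ba] := leP a b; last first.
  by rewrite set_itv_ge ?wlength0 ?measure0// bnd_simp -leNgt ltW.
rewrite wlength_itv_bnd// EFinB !right_lim_cdf /cdf.
have -> : `]a, b]%classic = `]-oo, b] `\` `]-oo, a] :> set R.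
  by rewrite -[RHS]setCK setCD setCitvl setUC -[LHS]setCK setCitv.
rewrite /mX measureD ?setIidr//; first exact: subset_itvl.
by rewrite -ge0_fin_numE// fin_num_measure.
Qed.

Lemma integral_stieltjes_law (D : set R) (f : R -> \bar R) :
  measurable D -> measurable_fun setT f -> (forall x, 0 <= f x)%E ->
  (\int[stieltjes G]_(x in D) f x = \int[P]_(w in X @^-1` D) f (X w))%E.
Proof.
move=> mD mf f0.
rewrite (eq_measure_integral (distribution P X')); last first.
  by move=> A mA _; exact: stieltjes_law.
rewrite ge0_integral_pushforward//.
exact: measurable_funTS.
Qed.

Hypothesis G0 : G t @[t --> 0^'+] --> 0.

Lemma probability_nonpos0 : P [set w | X w <= 0] = 0%E.
Proof.
have := right_lim_cdf 0; rewrite /cdf /distribution/= /pushforward => <-.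
by rewrite (cvg_unique _ (cvg_right_lim law_nondecreasing) G0).
Qed.

End StieltjesLaw.

Section LaplaceOfLaw.
Context d (Omega : measurableType d) (R : realType) (P : probability Omega R).
Variables (Y : {RV P >-> R}) (G : R -> R).
Hypothesis Y_law : forall t : R, P [set w | Y w < t] = (G t)%:E.
Hypothesis G_right0 : G t @[t --> 0^'+] --> 0.

Local Notation phi := (laplace_stieltjes G).

Lemma ae_law_gt0 : {ae P, forall w, 0 < Y w}.
Proof.
exists [set w | Y w <= 0]; split.
- by have := measurable_funPTI Y (measurable_itv `]-oo, 0]).
- exact: probability_nonpos0 Y_law G_right0.
- by move=> w /= /negP; rewrite -leNgt.
Qed.

(** The integral defining phi is over [0, +oo[ and real-valued: the first is
    harmless because Y > 0 almost surely, the second because the integrand is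
    bounded by 1 there. *)
Lemma expectation_laplace (s : R) : 0 <= s ->
  (\int[P]_w (expR (- (s * Y w)))%:E = (phi s)%:E)%E.
Proof.
move=> s0.
have mf : measurable_fun setT (fun w => (expR (- (s * Y w)))%:E).
  by apply/measurable_EFinP; exact: (measurableT_comp (measurable_expRN s)).
have mN : measurable (Y @^-1` `[0, +oo[) by exact: measurable_funPTI.
have E : (\int[P]_(w in Y @^-1` `[0%R, +oo[) (expR (- (s * Y w)))%:E =
    \int[P]_w (expR (- (s * Y w)))%:E)%E.
  rewrite [RHS](ge0_negligible_integral (N := ~` (Y @^-1` `[0, +oo[)))//.
  - by rewrite setDE setCK setTI.
  - exact: measurableC.
  - apply/eqP; rewrite eq_le measure_ge0 andbT.
    rewrite -(probability_nonpos0 Y_law G_right0); apply: le_measure;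
      rewrite ?inE.
    + exact: measurableC.
    + by have := measurable_funPTI Y (measurable_itv `]-oo, 0]).
    + by move=> w /=; rewrite in_itv/= andbT => /negP; rewrite -ltNge => /ltW.
rewrite /laplace_stieltjes /Rintegral.
have me : measurable_fun setT (fun x : R => (expR (- (s * x)))%:E).
  by apply/measurable_EFinP; exact: measurable_expRN.
rewrite (integral_stieltjes_law Y_law (measurable_itv `[0, +oo[) me)//.
have le1 : (\int[P]_(w in Y @^-1` `[0%R, +oo[) (expR (- (s * Y w)))%:E <= 1)%E.
  apply: (@le_trans _ _ (\int[P]_(w in Y @^-1` `[0%R, +oo[) (cst 1%E w))%E).
    apply: ge0_le_integral => //.
    - exact: measurable_funTS.
    - move=> w /=; rewrite in_itv/= andbT => Yw.
      by rewrite lee_fin expR_le1 oppr_le0 mulr_ge0.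
  by rewrite integral_cst// mul1e probability_le1.
rewrite fineK; first exact/esym/E.
rewrite ge0_fin_numE; first by rewrite (le_lt_trans le1)// ltry.
by apply: integral_ge0 => w _; rewrite lee_fin expR_ge0.
Qed.

Lemma laplace_ge0 s : 0 <= s -> 0 <= phi s.
Proof.
move=> s0; rewrite -lee_fin -expectation_laplace//.
by apply: integral_ge0 => w _; rewrite lee_fin expR_ge0.
Qed.

Lemma laplace_le1 s : 0 <= s -> phi s <= 1.
Proof.
move=> s0; rewrite -lee_fin -expectation_laplace//.
rewrite -(@probability_setT _ _ _ P) -[leRHS]mul1e -integral_cst//.
apply: ae_ge0_le_integral => //.
- by apply/measurable_EFinP; exact: (measurableT_comp (measurable_expRN s)).
- apply: filterS ae_law_gt0 => w Yw _.
  by rewrite lee_fin expR_le1 oppr_le0 mulr_ge0// ltW.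
Qed.

(** If the expectation of e^(-s Y) were 1, the variable 1 - e^(-s Y), which is
    almost surely positive, would have a null expectation. *)
Lemma laplace_lt1 s : 0 < s -> phi s < 1.
Proof.
move=> s0; rewrite lt_neqAle laplace_le1 ?ltW// andbT; apply/eqP => phi1.
have me : measurable_fun setT (fun w => expR (- (s * Y w))).
  exact: (measurableT_comp (measurable_expRN s)).
have e1 : (\int[P]_w `|(1 - expR (- (s * Y w)))%:E| = 0)%E.
  transitivity (\int[P]_w (1 - expR (- (s * Y w)))%:E)%E.
    apply: ae_eq_integral => //.
    + by apply: measurableT_comp => //; apply/measurable_EFinP;
        exact: measurable_funB.
    + by apply/measurable_EFinP; exact: measurable_funB.
    + apply: filterS ae_law_gt0 => w Yw _; rewrite gee0_abs// lee_fin subr_ge0.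
      by rewrite expR_le1 oppr_le0 mulr_ge0// ltW.
  under eq_integral do rewrite EFinB.
  have ie : P.-integrable setT (EFin \o (fun w => expR (- (s * Y w)))).
    apply/integrableP; split; first exact/measurable_EFinP.
    under eq_integral do rewrite /= ger0_norm ?expR_ge0//.
    by rewrite expectation_laplace ?ltW// ltry.
  rewrite integralB//=; last first.
    exact: finite_measure_integrable_cst.
  by rewrite expectation_laplace ?ltW// phi1 integral_cst_probability subee.
have ae0 : ae_eq P setT (fun w => (1 - expR (- (s * Y w)))%:E) (cst 0%E).
  apply/ae_eq_integral_abs => //.
  by apply/measurable_EFinP; exact: measurable_funB.
have : {ae P, forall w, False}.
  apply: filterS2 ae0 ae_law_gt0 => w /(_ I) [] /eqP.
  rewrite subr_eq0 eq_sym => /eqP e1' Yw.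
  have : expR (- (s * Y w)) < 1 by rewrite expR_lt1 oppr_lt0 mulr_gt0.
  by rewrite e1' ltxx.
move=> [N [mN PN0 NT]].
have NE : N = setT by apply/seteqP; split => // w _; exact: NT.
have := @probability_setT _ _ _ P; rewrite -NE PN0 => /eqP.
by rewrite eq_sym onee_eq0.
Qed.

End LaplaceOfLaw.

(** * A single particle *)

Section Discounts.
Context (R : realType).
Implicit Types (z : R) (xy : R * R).

(** The factors contributed to e^(-z T) by a pair (tau_k, eta_k): the first one
    when the particle is registered, the second one when it is the first to be
    lost. *)
Definition kept_discount (z : R) (xy : R * R) : R :=
  if xy.2 <= xy.1 then expR (- (z * xy.1)) else 0.
Definition lost_discount (z : R) (xy : R * R) : R :=
  if xy.1 < xy.2 then expR (- (z * xy.1)) else 0.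

Lemma measurable_kept_discount z : measurable_fun setT (kept_discount z).
Proof.
apply: measurable_fun_ifT => //.
  by apply: measurable_fun_ler; [exact: measurable_snd|exact: measurable_fst].
by apply: (measurableT_comp (measurable_expRN z)); exact: measurable_fst.
Qed.

Lemma measurable_lost_discount z : measurable_fun setT (lost_discount z).
Proof.
apply: measurable_fun_ifT => //.
  by apply: measurable_fun_ltr; [exact: measurable_fst|exact: measurable_snd].
by apply: (measurableT_comp (measurable_expRN z)); exact: measurable_fst.
Qed.

Lemma kept_discount_ge0 z xy : 0 <= kept_discount z xy.
Proof. by rewrite /kept_discount; case: ifP => // _; exact: expR_ge0. Qed.

Lemma lost_discount_ge0 z xy : 0 <= lost_discount z xy.
Proof. by rewrite /lost_discount; case: ifP => // _; exact: expR_ge0. Qed.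

End Discounts.

Section OneStep.
Context d (Omega : measurableType d) (R : realType) (P : probability Omega R).
Variables (X Y : {RV P >-> R}) (lambda : R) (G : R -> R).
Hypothesis lambda_gt0 : 0 < lambda.
Hypothesis X_law : forall t : R, 0 <= t ->
  P [set w | X w < t] = (1 - expR (- (lambda * t)))%:E.
Hypothesis Y_law : forall t : R, P [set w | Y w < t] = (G t)%:E.
Hypothesis G_right0 : G t @[t --> 0^'+] --> 0.
Hypothesis XY_indep : forall A B, measurable A -> measurable B ->
  P (X @^-1` A `&` Y @^-1` B) = (P (X @^-1` A) * P (Y @^-1` B))%E.

Local Notation phi := (laplace_stieltjes G).

Lemma ae_exponential_ge0 : {ae P, forall w, 0 <= X w}.
Proof.
exists [set w | X w < 0]; split.
- by have := measurable_funPTI X (measurable_itv `]-oo, 0[).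
- by rewrite X_law// mulr0 oppr0 expR0 subrr.
- by move=> w /= /negP; rewrite -ltNge.
Qed.

(** Since e^(-z x) is the probability that an exponential time Z of rate z
    exceeds x, the left-hand side is the probability that y <= X < Z. *)
Lemma integral_race (z y : R) : 0 < z -> 0 <= y ->
  (\int[P]_w (kept_discount z (X w, y))%:E =
   (lambda / (lambda + z) * expR (- ((z + lambda) * y)))%:E)%E.
Proof.
move=> z0 y0; rewrite /kept_discount/=.
have mp : measurable_fun setT (fun x : R => y <= x)
  by exact: measurable_fun_ler.
have mh : measurable_fun setT (fun t : R => z * expR (- (z * t))).
  by apply: measurable_funM => //; exact: measurable_expRN.
have h0 x t : y <= x -> x < t -> 0 <= z * expR (- (z * t)).
  by move=> _ _; rewrite mulr_ge0 ?expR_ge0// ltW.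
have := integral_tail_tonelli X mp mh h0.
under eq_integral do rewrite integral_expRN_tail//.
rewrite (_ : (fun w => _) =
  (fun w => (if y <= X w then expR (- (z * X w)) else 0)%:E)); last first.
  by apply/funext => w; case: ifP.
move=> ->; rewrite -integral_race_tail// [RHS]integral_mkcond.
apply: eq_integral => t _; rewrite patchE mem_setE in_itv/= andbT.
case: ifPn => [yt|]; last first.
  rewrite -leNgt => ty; rewrite (_ : [set w | _] = set0) ?measure0 ?mule0//.
  apply/seteqP; split => // w /= /andP[yX Xt].
  by have := lt_le_trans Xt (le_trans ty yX); rewrite ltxx.
rewrite [RHS]EFinM; congr (_ * _)%E.
have mlt u : measurable [set w | X w < u].
  by have := measurable_funPTI X (measurable_itv `]-oo, u[).
rewrite (_ : [set w | _] = [set w | X w < t] `\` [set w | X w < y]); last first.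
  apply/seteqP; split => w /=; first by move=> /andP[yX ->]; rewrite ltNge yX.
  by move=> [-> /negP]; rewrite -leNgt => ->.
rewrite measureD//; last first.
  by rewrite (le_lt_trans (probability_le1 _ _)) ?ltry.
rewrite setIidr; last by move=> w /= /lt_trans; apply.
have t0 : 0 <= t by rewrite (le_trans y0)// ltW.
have /= -> := X_law t0; have /= -> := X_law y0.
by rewrite -EFinB; congr EFin; ring.
Qed.

Lemma integral_exponential_discount (z : R) : 0 < z ->
  (\int[P]_w (expR (- (z * X w)))%:E = (lambda / (lambda + z))%:E)%E.
Proof.
move=> z0; have := integral_race z0 (lexx 0);
  rewrite mulr0 oppr0 expR0 mulr1 => <-.
have me : measurable_fun setT (fun w => expR (- (z * X w))).
  exact: (measurableT_comp (measurable_expRN z)).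
apply: ae_eq_integral => //; first exact/measurable_EFinP.
- apply/measurable_EFinP; apply: measurable_fun_ifT => //.
  by apply: measurable_fun_ler.
- by apply: filterS ae_exponential_ge0 => w X0 _; rewrite /kept_discount/= X0.
Qed.

Lemma integral_kept_discount (z : R) : 0 < z ->
  (\int[P]_w (kept_discount z (X w, Y w))%:E =
   (lambda / (lambda + z) * phi (z + lambda))%:E)%E.
Proof.
move=> z0; rewrite
  (integral_indep_pair (f := fun xy => (kept_discount z xy)%:E) XY_indep);
  last 2 first.
- by apply/measurable_EFinP; exact: measurable_kept_discount.
- by move=> xy; rewrite lee_fin kept_discount_ge0.
have zl0 : 0 <= z + lambda by rewrite ltW// addr_gt0.
have lz0 : 0 <= lambda / (lambda + z) by rewrite divr_ge0 ?addr_ge0// ltW.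
have me : measurable_fun setT (fun w => expR (- ((z + lambda) * Y w))).
  exact: (measurableT_comp (measurable_expRN (z + lambda))).
rewrite EFinM -(expectation_laplace Y_law G_right0 zl0) -ge0_integralZl_EFin//;
  last exact/measurable_EFinP.
pose f (vw : Omega * Omega) := (kept_discount z (X vw.1, Y vw.2))%:E.
have mf : measurable_fun setT f.
  apply/measurable_EFinP;
    apply: (measurableT_comp (measurable_kept_discount z)).
  by apply: measurable_fun_pair; apply: measurableT_comp.
have f0 vw : (0 <= f vw)%E by rewrite lee_fin kept_discount_ge0.
apply: ae_eq_integral => //.
- exact: (@measurable_fun_fubini_tonelli_G _ _ _ _ _ P f mf f0).
- by apply: measurable_funeM; exact/measurable_EFinP.
- apply: filterS (ae_law_gt0 Y_law G_right0) => w Yw _.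
  by rewrite integral_race// ltW.
Qed.

(** The two discounts add up to e^(-z X). *)
Lemma integral_lost_discount (z : R) : 0 < z ->
  (\int[P]_w (lost_discount z (X w, Y w))%:E =
   (lambda / (lambda + z) * (1 - phi (z + lambda)))%:E)%E.
Proof.
move=> z0.
have mXY : measurable_fun setT (fun w => (X w, Y w))
  by exact: measurable_fun_pair.
have ms : measurable_fun setT (fun w => kept_discount z (X w, Y w)).
  exact: (measurableT_comp (measurable_kept_discount z)).
have ml : measurable_fun setT (fun w => lost_discount z (X w, Y w)).
  exact: (measurableT_comp (measurable_lost_discount z)).
have := integral_exponential_discount z0.
rewrite (_ : (fun w => _) =
  (fun w => (kept_discount z (X w, Y w))%:E +
    (lost_discount z (X w, Y w))%:E)%E); last first.
  apply/funext => w; rewrite /kept_discount /lost_discount/= -EFinD.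
  by case: (leP (Y w) (X w)) => _; rewrite ?addr0 ?add0r.
rewrite ge0_integralD//; last 4 first.
- by move=> w _; rewrite lee_fin kept_discount_ge0.
- exact/measurable_EFinP.
- by move=> w _; rewrite lee_fin lost_discount_ge0.
- exact/measurable_EFinP.
rewrite integral_kept_discount// => /eqP; rewrite addeC eq_sym -sube_eq//;
  last by rewrite fin_num_adde_defl.
by move=> /eqP <-; rewrite -EFinB; congr EFin; ring.
Qed.

End OneStep.

(** * The Laplace transform near lambda *)

Section Quotient.
Context (R : realType).

Lemma cvg_expRN_seq (z_ : nat -> R) (c x : R) : z_ n @[n --> \oo] --> 0 ->
  expR (- ((c * z_ n) * x)) @[n --> \oo] --> (1 : R).
Proof.
move=> z0; rewrite -(@expR0 R).
apply: continuous_cvg; first exact: continuous_expR.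
rewrite -oppr0; apply: cvgN; rewrite -(mul0r x); apply: cvgM;
  last exact: cvg_cst.
by rewrite -(mulr0 c); apply: cvgM => //; exact: cvg_cst.
Qed.

(** Both bounds are the inequality 1 + u <= e^u, at u = z x and u = - z x. *)
Lemma expRN_quotient_bounds (z x : R) : 0 < z ->
  x * expR (- (z * x)) <= (1 - expR (- (z * x))) / z <= x.
Proof.
move=> z0; rewrite ler_pdivlMr// ler_pdivrMr//; apply/andP; split.
  have := expR_ge1Dx (z * x); rewrite -(ler_pM2r (expR_gt0 (- (z * x)))).
  rewrite expRxMexpNx_1 mulrDl mul1r; lra.
by have := expR_ge1Dx (- (z * x)); lra.
Qed.

Lemma cvg_expRN_quotient (z_ : nat -> R) (x : R) : (forall n, 0 < z_ n) ->
  z_ n @[n --> \oo] --> 0 ->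
  (1 - expR (- (z_ n * x))) / z_ n @[n --> \oo] --> x.
Proof.
move=> zp z0; apply: (@squeeze_cvgr _ _ _ _
  (fun n => x * expR (- (z_ n * x))) (fun=> x)).
- by near=> n; exact: expRN_quotient_bounds.
- rewrite -[X in _ --> X]mulr1; apply: cvgM; first exact: cvg_cst.
  by have := cvg_expRN_seq 1 x z0; under eq_fun do rewrite mul1r.
- exact: cvg_cst.
Unshelve. all: by end_near. Qed.

End Quotient.

Section LaplaceDerivative.
Context d (Omega : measurableType d) (R : realType) (P : probability Omega R).

Lemma bounded_cvg_expectation (f_ : nat -> Omega -> R) (f : Omega -> R)
  (M : R) :
  (forall n, measurable_fun setT (f_ n)) -> measurable_fun setT f ->
  (forall w, f_ n w @[n --> \oo] --> f w) ->
  (forall n w, `|f_ n w| <= M) ->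
  (\int[P]_w (f_ n w)%:E @[n --> \oo] --> \int[P]_w (f w)%:E)%E.
Proof.
move=> mf_ mf cf bf.
apply: (@dominated_cvg _ _ _ P setT measurableT (fun n w => (f_ n w)%:E)
  (fun w => (f w)%:E) (fun=> M%:E)) => //.
- by move=> n; exact/measurable_EFinP.
- by move=> w _; apply: cvg_EFin; [exact: nearW|exact: cf].
- exact: finite_measure_integrable_cst.
- by move=> n w _; rewrite lee_fin.
Qed.

Variables (Y : {RV P >-> R}) (lambda : R) (G : R -> R).
Hypothesis lambda_gt0 : 0 < lambda.
Hypothesis Y_law : forall t : R, P [set w | Y w < t] = (G t)%:E.
Hypothesis G_right0 : G t @[t --> 0^'+] --> 0.
Hypothesis Y_ge0 : forall w, 0 <= Y w.

Local Notation phi := (laplace_stieltjes G).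
Local Notation intG :=
  (\int[lebesgue_measure]_(t in `[0, +oo[) (t * expR (- (lambda * t)) * G t)).

Let mexp c : measurable_fun setT (fun w => expR (- (c * Y w))).
Proof. exact: (measurableT_comp (measurable_expRN c)). Qed.

Let mYexp : measurable_fun setT (fun w => Y w * expR (- (lambda * Y w))).
Proof. exact: measurable_funM. Qed.

Lemma mul_expRN_le (x : R) : x * expR (- (lambda * x)) <= lambda^-1.
Proof.
have := ltr_expRN (lambda * x); rewrite -mulrA -ltr_pdivlMl// mulr1.
exact: ltW.
Qed.

(** Tonelli: (y + 1 / lambda) e^(-lambda y) / lambda is the integral of
    t e^(-lambda t) over t > y, and G(t) = P(Y < t). *)
Lemma expectation_tail_G :
  (\int[P]_w ((Y w + lambda^-1) * expR (- (lambda * Y w)) / lambda)%:E =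
    intG%:E)%E.
Proof.
have mp : measurable_fun setT (fun x : R => 0 <= x)
  by exact: measurable_fun_ler.
have mh : measurable_fun setT (fun t : R => t * expR (- (lambda * t))).
  by apply: measurable_funM => //; exact: measurable_expRN.
have h0 x t : 0 <= x -> x < t -> 0 <= t * expR (- (lambda * t)).
  by move=> x0 /ltW xt; rewrite mulr_ge0 ?expR_ge0// (le_trans x0).
have := integral_tail_tonelli Y mp mh h0.
rewrite (_ : (fun w => _) =
    (fun w => ((Y w + lambda^-1) * expR (- (lambda * Y w)) / lambda)%:E));
      last first.
  by apply/funext => w; rewrite Y_ge0 integral_mul_expRN_tail.
rewrite (_ : (\int[_]_t _)%E =
    (\int[lebesgue_measure]_(t in `[0%R, +oo[)
      (t * expR (- (lambda * t)) * G t)%:E)%E); last first.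
  rewrite [RHS]integral_mkcond; apply: eq_integral => t _.
  rewrite patchE mem_setE in_itv/= andbT.
  case: ifPn => [t0|]; last first.
    rewrite -ltNge => t0; rewrite (_ : [set w | _] = set0) ?measure0 ?mule0//.
    apply/seteqP; split => // w /= /andP[Y0 Yt].
    by have := lt_trans (le_lt_trans Y0 Yt) t0; rewrite ltxx.
  rewrite [RHS]EFinM; congr (_ * _)%E; rewrite -Y_law; congr (P _).
  by apply/seteqP; split => w /=; rewrite Y_ge0.
move=> E; rewrite E /Rintegral fineK// -E.
apply: integrable_fin_num => //.
apply: (@le_integrable _ _ _ P setT measurableT _
  (fun=> ((lambda^-1 + lambda^-1 * 1) / lambda)%:E)).
- apply/measurable_EFinP; apply: measurable_funM => //.
  by apply: measurable_funM => //; exact: measurable_funD.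
- move=> w _; rewrite lee_fin !ger0_norm.
  + rewrite ler_pM2r ?invr_gt0// mulrDl lerD ?mul_expRN_le//.
    rewrite ler_pM2l ?invr_gt0// expR_le1 oppr_le0 mulr_ge0//.
    exact: ltW.
  + by rewrite divr_ge0 ?addr_ge0 ?mulr_ge0 ?invr_ge0// ltW.
  + rewrite divr_ge0 ?mulr_ge0 ?addr_ge0 ?invr_ge0 ?expR_ge0//; exact: ltW.
- exact: finite_measure_integrable_cst.
Qed.

Lemma expectation_mul_expRN :
  (\int[P]_w (Y w * expR (- (lambda * Y w)))%:E =
    (lambda * intG - phi lambda / lambda)%:E)%E.
Proof.
have l0 : 0 <= lambda^-1 by rewrite invr_ge0 ltW.
have := expectation_tail_G.
rewrite (_ : (fun w => _) = (fun w => lambda^-1%:E *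
    ((Y w * expR (- (lambda * Y w)))%:E + lambda^-1%:E *
      (expR (- (lambda * Y w)))%:E))%E); last first.
  by apply/funext => w; rewrite -!EFinM; congr EFin; ring.
have nn1 w : (0 <= (Y w * expR (- (lambda * Y w)))%:E)%E.
  by rewrite lee_fin mulr_ge0// expR_ge0.
have nn2 w : (0 <= lambda^-1%:E * (expR (- (lambda * Y w)))%:E)%E.
  by rewrite lee_fin mulr_ge0// expR_ge0.
rewrite ge0_integralZl_EFin//; last 2 first.
- by move=> w _; rewrite adde_ge0.
- apply: emeasurable_funD; first exact/measurable_EFinP.
  by apply: measurable_funeM; exact/measurable_EFinP.
rewrite ge0_integralD//; last 2 first.
- exact/measurable_EFinP.
- by apply: measurable_funeM; exact/measurable_EFinP.
rewrite ge0_integralZl_EFin//; last exact/measurable_EFinP.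
rewrite (expectation_laplace Y_law)//; last exact: ltW.
set b := (\int[P]_w _)%E => E.
have lN0 : lambda != 0 by rewrite gt_eqF.
have bfin : b \is a fin_num.
  rewrite ge0_fin_numE ?integral_ge0//.
  rewrite ltey; apply/eqP => by_; move: E.
  by rewrite by_ addye// gt0_muley// lte_fin invr_gt0.
move: E; rewrite -(fineK bfin) -!(EFinM, EFinD) => -[<-].
by congr EFin; field.
Qed.

Variable z_ : nat -> R.
Hypotheses (z_gt0 : forall n, 0 < z_ n) (z_cvg0 : z_ n @[n --> \oo] --> 0).

Lemma cvg_laplace (c : R) : 0 <= c ->
  phi (c * z_ n + lambda) @[n --> \oo] --> phi lambda.
Proof.
move=> c0.
have cz0 n : 0 <= c * z_ n by rewrite mulr_ge0// ltW.
rewrite (_ : (fun n => _) =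
    fine \o (fun n => \int[P]_w (expR (- ((c * z_ n + lambda) * Y w)))%:E)%E);
      last first.
  apply/funext => n /=; rewrite (expectation_laplace Y_law)//.
  by rewrite addr_ge0// ltW.
apply: fine_cvg; rewrite -(expectation_laplace Y_law G_right0 (ltW lambda_gt0)).
apply: (@bounded_cvg_expectation _ _ 1) => //.
- move=> w; rewrite -[X in _ --> X]mul1r.
  rewrite (_ : (fun n => _) =
    (fun n => expR (- (c * z_ n * Y w)) * expR (- (lambda * Y w)))); last first.
    by apply/funext => n; rewrite -expRD; congr expR; ring.
  by apply: cvgM; [exact: cvg_expRN_seq|exact: cvg_cst].
- move=> n w; rewrite ger0_norm ?expR_ge0// expR_le1 oppr_le0 mulr_ge0//
    addr_ge0//.
  exact: ltW.
Qed.

(** The quotient is the expectation of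
    e^(-lambda Y) e^(-z Y) (1 - e^(-z Y)) / z, which converges to
    Y e^(-lambda Y) and is bounded by 1 / lambda. *)
Lemma cvg_laplace_quotient :
  (phi (z_ n + lambda) - phi (2 * z_ n + lambda)) / z_ n @[n --> \oo] -->
    lambda * intG - phi lambda / lambda.
Proof.
pose f_ n w := (expR (- ((z_ n + lambda) * Y w)) -
  expR (- ((2 * z_ n + lambda) * Y w))) / z_ n.
have fE n w : f_ n w = expR (- (lambda * Y w)) * expR (- (1 * z_ n * Y w)) *
    ((1 - expR (- (z_ n * Y w))) / z_ n).
  rewrite /f_ mulrA; congr (_ / _); rewrite mulrBr mulr1 -!expRD.
  by congr (expR _ - expR _); ring.
have int_f n : ((phi (z_ n + lambda) - phi (2 * z_ n + lambda)) / z_ n)%:E =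
    (\int[P]_w (f_ n w)%:E)%E.
  have z1 : 0 <= z_ n + lambda by rewrite addr_ge0// ltW.
  have z2 : 0 <= 2 * z_ n + lambda by rewrite addr_ge0 ?mulr_ge0// ltW.
  have ie s : 0 <= s -> P.-integrable setT (fun w => (expR (- (s * Y w)))%:E).
    move=> s0; apply/integrableP; split; first exact/measurable_EFinP.
    under eq_integral do rewrite /= ger0_norm ?expR_ge0//.
    by rewrite (expectation_laplace Y_law)// ltry.
  rewrite /f_; under eq_integral do rewrite EFinM EFinB.
  rewrite integralZr//; last by apply: integrableB => //; exact: ie.
  by rewrite integralB// ?(expectation_laplace Y_law)//; exact: ie.
rewrite (_ : (fun n => _) = fine \o (fun n => \int[P]_w (f_ n w)%:E)%E);
  last first.
  by apply/funext => n /=; rewrite -int_f.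
apply: fine_cvg; rewrite -expectation_mul_expRN.
apply: (@bounded_cvg_expectation _ _ lambda^-1) => //.
- move=> n; apply: measurable_funM => //; exact: measurable_funB.
- move=> w; rewrite (_ : (fun n => _) = (fun n => expR (- (lambda * Y w)) *
      expR (- (1 * z_ n * Y w)) * ((1 - expR (- (z_ n * Y w))) / z_ n)));
        last first.
    by apply/funext => n; exact: fE.
  rewrite [X in _ --> X](_ : _ = expR (- (lambda * Y w)) * 1 * Y w);
    last by ring.
  apply: cvgM; last exact: cvg_expRN_quotient.
  by apply: cvgM; [exact: cvg_cst|exact: cvg_expRN_seq].
- move=> n w; rewrite fE.
  have /andP[q1 q2] := expRN_quotient_bounds (Y w) (z_gt0 n).
  have q0 : 0 <= (1 - expR (- (z_ n * Y w))) / z_ n.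
    by rewrite (le_trans _ q1)// mulr_ge0// expR_ge0.
  have e0 : 0 <= expR (- (lambda * Y w)) * expR (- (1 * z_ n * Y w)).
    by rewrite mulr_ge0 ?expR_ge0.
  rewrite ger0_norm; last exact: mulr_ge0.
  rewrite (le_trans _ (mul_expRN_le (Y w)))//.
  rewrite [leRHS]mulrC; apply: ler_pM => //.
  by rewrite ler_piMr ?expR_ge0// expR_le1 oppr_le0 mul1r mulr_ge0// ltW.
Qed.

End LaplaceDerivative.

(** * The Laplace transform of the lossless time *)

Section FirstLoss.
Context (Omega : Type) (R : realType) (tau eta : nat -> Omega -> R).

Variant first_loss_spec (w : Omega) : option nat -> Prop :=
| FirstLoss n of tau n w < eta n w &
    (forall k, (k < n)%N -> eta k w <= tau k w) : first_loss_spec w (Some n)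
| NoLoss of (forall k, eta k w <= tau k w) : first_loss_spec w None.

Lemma first_lossP w : first_loss_spec w (first_loss tau eta w).
Proof.
rewrite /first_loss; case: pselect => [ex|nex].
  case: ex_minnP => n lossn minn; constructor => // k kn.
  by rewrite leNgt; apply/negP => /minn; rewrite leqNgt kn.
by constructor => k; rewrite leNgt; apply/negP => lossk; apply: nex; exists k.
Qed.

End FirstLoss.

Section DiscountStep.
Context (R : realType).

(** With this step and the initial value 1, the state after n pairs is
    e^(-z t_n) if none of the first n particles is lost, and 0 otherwise
    ([history_kept], [history_lost]). *)
Definition discount_step (z : R) (uxy : R * (R * R)) : R :=
  uxy.1 * kept_discount z uxy.2.

Lemma measurable_discount_step z : measurable_fun setT (discount_step z).
Proof.
apply: measurable_funM; first exact: measurable_fst.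
by apply: (measurableT_comp (measurable_kept_discount z));
  exact: measurable_snd.
Qed.

HB.instance Definition _ z :=
  isMeasurableFun.Build _ _ _ _ (discount_step z) (measurable_discount_step z).

End DiscountStep.

Section Transform.
Context d (Omega : measurableType d) (R : realType) (P : probability Omega R).
Variables (tau eta : nat -> {RV P >-> R}) (lambda : R) (G : R -> R).
Local Notation T := (lossless_time tau eta).
Local Notation phi := (laplace_stieltjes G).
Local Notation U z := (history tau eta (discount_step z) 1).

Lemma history_kept z n w : (forall k, (k < n)%N -> eta k w <= tau k w) ->
  U z n w = expR (- (z * \sum_(i < n) tau i w)).
Proof.
elim: n => [|n IH] kept /=; first by rewrite big_ord0 mulr0 oppr0 expR0.
rewrite /discount_step/= IH => [|k kn]; last by apply: kept; exact: ltnW.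
by rewrite /kept_discount/= kept// -expRD big_ord_recr/=; congr expR; ring.
Qed.

Lemma history_lost z n k w : (k < n)%N -> tau k w < eta k w -> U z n w = 0.
Proof.
elim: n => [//|n IH] + lossk; rewrite ltnS leq_eqVlt /= => /predU1P[<-|kn].
  by rewrite /discount_step/kept_discount/= leNgt lossk mulr0.
by rewrite /discount_step/= IH// mul0r.
Qed.

Lemma history_ge0 z n w : 0 <= U z n w.
Proof.
elim: n => [|n IH]/=; first exact: ler01.
by rewrite /discount_step/= mulr_ge0// kept_discount_ge0.
Qed.

(** At most one term of the series is nonzero, the one whose index is that of
    the first loss.  Without any loss T is infinite, and z > 0 makes the
    left-hand side vanish. *)
Lemma discounted_lossless_time z w : 0 < z ->
  (expeR (- (z%:E * T w)) =
   \sum_(0 <= n <oo) (U z n w * lost_discount z (tau n w, eta n w))%:E)%E.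
Proof.
move=> z0; rewrite /lossless_time; case: first_lossP => [n lossn kept|kept].
- rewrite (nneseriesD1 (n := n))//; last first.
    by move=> k _; rewrite lee_fin mulr_ge0 ?history_ge0 ?lost_discount_ge0.
  rewrite eseries0 ?adde0.
    rewrite history_kept// /lost_discount/= lossn/= -expRD big_ord_recr/=.
    by congr ((expR _)%:E); ring.
  move=> k _ /= kn; move: (kn); rewrite neq_ltn => /orP[lt_kn|lt_nk].
    by rewrite /lost_discount/= ltNge kept// mulr0.
  by rewrite (history_lost z lt_nk)// mul0r.
- rewrite eseries0 ?gt0_muley ?lte_fin//= => k _ _.
  by rewrite /lost_discount/= ltNge kept// mulr0.
Qed.

Lemma measurable_discounted z : 0 < z ->
  measurable_fun setT (fun w => expeR (- (z%:E * T w))%E).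
Proof.
move=> z0; apply: (eq_measurable_fun
  (fun w => \sum_(0 <= n <oo)
    (U z n w * lost_discount z (tau n w, eta n w))%:E)%E).
  by move=> w _; rewrite discounted_lossless_time.
apply: (ge0_emeasurable_sum (P := xpredT)) => [n w _ _|n _].
  by rewrite lee_fin mulr_ge0 ?history_ge0 ?lost_discount_ge0.
apply/measurable_EFinP; apply: measurable_funM; first exact: measurable_history.
by apply: (measurableT_comp (measurable_lost_discount z));
  exact: measurable_fun_pair.
Qed.

Hypotheses (lambda_gt0 : 0 < lambda)
    (tau_indep : mutually_independent tau)
    (eta_indep : mutually_independent eta)
    (tau_eta_indep : independent_seqs tau eta)
    (tau_law : forall (k : nat) (t : R), 0 <= t ->
       P [set w | tau k w < t] = (1 - expR (- (lambda * t)))%:E)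
    (eta_law : forall (k : nat) (t : R), P [set w | eta k w < t] = (G t)%:E)
    (G_right0 : G t @[t --> 0^'+] --> 0).

(** The state at n is independent of the pair of index n. *)
Lemma integral_history_mul z n (g : R * R -> R) : measurable_fun setT g ->
  (forall xy, 0 <= g xy) ->
  (\int[P]_w (U z n w * g (tau n w, eta n w))%:E =
   (\int[P]_w (U z n w)%:E) * \int[P]_w (g (tau n w, eta n w))%:E)%E.
Proof.
move=> mg g0.
have U0 w : (0 <= (U z n w)%:E)%E by rewrite lee_fin history_ge0.
have mU : measurable_fun setT (fun w => (U z n w)%:E).
  by apply/measurable_EFinP; exact: measurable_history.
have mgW : measurable_fun setT (fun w => (g (tau n w, eta n w))%:E).
  by apply/measurable_EFinP; apply: measurableT_comp => //;
    exact: measurable_fun_pair.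
(* The absolute value makes f nonnegative on the whole product; it disappears
   on the nonnegative values of the state. *)
pose f (uxy : R * (R * R)) : \bar R := (`|uxy.1| * g uxy.2)%:E.
have mf : measurable_fun setT f.
  apply/measurable_EFinP; apply: measurable_funM.
    by apply: measurableT_comp => //; exact: measurable_fst.
  by apply: measurableT_comp => //; exact: measurable_snd.
have f0 uxy : (0 <= f uxy)%E by rewrite lee_fin mulr_ge0.
have H := @history_indep _ _ _ _ _ P tau eta (discount_step z) 1
  tau_indep eta_indep tau_eta_indep n.
have := integral_indep_pair H mf f0.
rewrite /f/=; under eq_integral do rewrite ger0_norm ?history_ge0//.
move=> ->; rewrite [RHS]muleC -ge0_integralZr//; last first.
- exact: integral_ge0.
- by move=> w _; rewrite lee_fin.
apply: eq_integral => w _; rewrite -ge0_integralZl_EFin//.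
by apply: eq_integral => v _; rewrite ger0_norm ?history_ge0// -EFinM mulrC.
Qed.

Let XY_indep n (A B : set R) : measurable A -> measurable B ->
  P (tau n @^-1` A `&` eta n @^-1` B) =
    (P (tau n @^-1` A) * P (eta n @^-1` B))%E.
Proof. exact: probability_pair. Qed.

Lemma integral_history z n : 0 < z ->
  (\int[P]_w (U z n w)%:E =
    ((lambda / (lambda + z) * phi (z + lambda)) ^+ n)%:E)%E.
Proof.
move=> z0; elim: n => [|n IH] /=.
  by rewrite integral_cst_probability.
rewrite /discount_step/= integral_history_mul; last 2 first.
- exact: measurable_kept_discount.
- exact: kept_discount_ge0.
rewrite IH (integral_kept_discount lambda_gt0 (tau_law n) (eta_law n))//;
  last exact: XY_indep.
by rewrite -EFinM exprSr.
Qed.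

(** Term by term, the series for e^(-z T) integrates to a geometric series. *)
Lemma laplace_lossless_time z : 0 < z ->
  (\int[P]_w expeR (- (z%:E * T w)) =
   (lambda * (1 - phi (z + lambda))
     / (z + lambda * (1 - phi (z + lambda))))%:E)%E.
Proof.
move=> z0.
under eq_integral do rewrite discounted_lossless_time//.
rewrite integral_nneseries//; last 2 first.
- move=> n; apply/measurable_EFinP; apply: measurable_funM.
    exact: measurable_history.
  by apply: (measurableT_comp (measurable_lost_discount z));
    exact: measurable_fun_pair.
- by move=> n w _; rewrite lee_fin mulr_ge0 ?history_ge0 ?lost_discount_ge0.
pose A := lambda / (lambda + z) * phi (z + lambda).
pose B := lambda / (lambda + z) * (1 - phi (z + lambda)).
have termE n : (\int[P]_w (U z n w * lost_discount z (tau n w, eta n w))%:E =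
  (geometric B A n)%:E)%E.
  rewrite integral_history_mul; last 2 first.
  - exact: measurable_lost_discount.
  - exact: lost_discount_ge0.
  rewrite integral_history//
    (integral_lost_discount lambda_gt0 (tau_law n) (eta_law n))//;
      last exact: XY_indep.
  by rewrite -EFinM mulrC.
rewrite (eq_eseriesr (g := fun n => (geometric B A n)%:E)) => [|n _];
  last exact: termE.
have zl0 : 0 <= z + lambda by rewrite ltW// addr_gt0.
have p0 := laplace_ge0 (eta_law 0) G_right0 zl0.
have p1 := laplace_le1 (eta_law 0) G_right0 zl0.
have lz0 : 0 < lambda + z by rewrite addr_gt0.
have A0 : 0 <= A by rewrite mulr_ge0// divr_ge0// ltW.
have A1 : A < 1.
  rewrite /A mulrAC ltr_pdivrMr// mul1r.
  by rewrite (@le_lt_trans _ _ lambda) ?ltrDl// ler_piMr// ltW.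
have := @cvg_geometric_series _ B A; rewrite ger0_norm// => /(_ A1) cvgAB.
transitivity ((B / (1 - A))%:E).
  apply/cvg_lim => //; under eq_fun do rewrite sumEFin.
  by apply: cvg_EFin; [exact: nearW|exact: cvgAB].
congr EFin; rewrite /A /B.
have d0 : z + lambda * (1 - phi (z + lambda)) != 0.
  by rewrite gt_eqF// ltr_pwDl// mulr_ge0// ?subr_ge0// ltW.
have lz0' : lambda + z != 0 by rewrite gt_eqF.
by field; rewrite d0 lz0'.
Qed.

End Transform.

(** * Moments from the Laplace transform *)

Section Discount.
Context (R : realType).
Implicit Types (z : R) (x : \bar R).

(** For z > 0 this is e^(-z x), with value 0 at +oo. *)
Definition discount z x : R := fine (expeR (- (z%:E * x))%E).

Lemma discountE z x : 0 < z -> (0 <= x)%E ->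
  expeR (- (z%:E * x))%E = (discount z x)%:E.
Proof.
by rewrite /discount; case: x => [r||]//= z0 _; rewrite gt0_muley ?lte_fin.
Qed.

Lemma discount_ge0 z x : 0 < z -> (0 <= x)%E -> 0 <= discount z x.
Proof. by move=> z0 x0; rewrite -lee_fin -discountE// expeR_ge0. Qed.

Lemma discount_le1 z x : 0 < z -> (0 <= x)%E -> discount z x <= 1.
Proof.
move=> z0 x0; rewrite -lee_fin -discountE// -(@expeR0 R) lee_expeR oppe_le0.
by rewrite mule_ge0// lee_fin ltW.
Qed.

Lemma discount_double z x : 0 < z -> (0 <= x)%E ->
  discount (2 * z) x = discount z x ^+ 2.
Proof.
rewrite /discount; case: x => [r||]//= z0 _.
  by rewrite expr2 -expRD; congr expR; ring.
by rewrite !gt0_muley ?lte_fin ?mulr_gt0//= expr2 mul0r.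
Qed.

Lemma cvg_discount_quotient (z_ : nat -> R) x : (forall n, 0 < z_ n) ->
  z_ n @[n --> \oo] --> 0 -> (-oo < x)%E ->
  ((1 - discount (z_ n) x) / z_ n)%:E @[n --> \oo] --> x.
Proof.
move=> zp z0; case: x => [r _|_|//].
  by apply: cvg_EFin; [exact: nearW|exact: cvg_expRN_quotient].
rewrite (_ : (fun n => _) = (fun n => ((z_ n)^-1)%:E)); last first.
  apply/funext => n; rewrite /discount gt0_muley ?lte_fin//=.
  by rewrite subr0 mul1r.
apply/cvgeryP; apply/gtr0_cvgV0.
  by apply: nearW => n; rewrite invr_gt0.
suff -> : unstable.inv_fun (fun n => (z_ n)^-1) = z_ by [].
by apply/funext => n; rewrite /= invrK.
Qed.

(** Along this sequence z is halved at each step, so that e^(-z T) is replaced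
    by its square root: the monotonicity of (1 - e^(-z T)) / z in z becomes
    (1 - y^2) / 2 <= 1 - y. *)
Definition halving (n : nat) : R := (2 ^+ n)^-1.

Lemma halving_gt0 n : 0 < halving n.
Proof. by rewrite invr_gt0 exprn_gt0. Qed.

Lemma halvingS n : halving n = 2 * halving n.+1.
Proof. by rewrite /halving exprS invfM mulrA divff ?mul1r. Qed.

Lemma cvg_halving : halving n @[n --> \oo] --> 0.
Proof.
rewrite (_ : halving = geometric 1 2^-1); last first.
  by apply/funext => n; rewrite /halving /geometric/= mul1r exprVn.
by apply: cvg_geometric; rewrite ger0_norm ?invr_ge0//; lra.
Qed.

Lemma discount_quotient_ge0 z x : 0 < z -> (0 <= x)%E ->
  0 <= (1 - discount z x) / z.
Proof.
by move=> z0 x0; rewrite divr_ge0 ?subr_ge0 ?discount_le1// ltW.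
Qed.

Lemma nondecreasing_discount_quotient x : (0 <= x)%E ->
  {homo (fun n => (1 - discount (halving n) x) / halving n) :
    m n / (m <= n)%N >-> m <= n}.
Proof.
move=> x0; apply/nondecreasing_seqP => n.
have z0 := halving_gt0 n.+1.
rewrite halvingS discount_double// ler_pdivrMr ?mulr_gt0// mulrA.
rewrite [(1 - _) / _ * 2]mulrAC divfK ?gt_eqF//.
have := discount_ge0 z0 x0; have := discount_le1 z0 x0; nra.
Qed.

End Discount.

Section MomentLimits.
Context d (Omega : measurableType d) (R : realType) (P : probability Omega R).
Variable T : Omega -> \bar R.
Hypothesis T_ge0 : forall w, (0 <= T w)%E.
Hypothesis mT : measurable_fun setT T.
Variable L : R -> R.
Hypothesis T_laplace : forall z, 0 < z ->
  (\int[P]_w expeR (- (z%:E * T w)) = (L z)%:E)%E.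

Lemma measurable_discount z : 0 < z ->
  measurable_fun setT (fun w => discount z (T w)).
Proof.
move=> z0; apply: (eq_measurable_fun
  (fun w => if T w \is a fin_num then expR (- (z * fine (T w))) else 0)).
  move=> w _; rewrite /discount; have := T_ge0 w; case: (T w) => [r||]//= _.
  by rewrite gt0_muley ?lte_fin.
apply: measurable_fun_ifT => //.
  by apply: (measurable_fun_bool true); exact/emeasurable_fin_num.
apply: (measurableT_comp (measurable_expRN z)).
exact: measurableT_comp.
Qed.

Lemma integral_discount z : 0 < z ->
  (\int[P]_w (discount z (T w))%:E = (L z)%:E)%E.
Proof.
move=> z0; rewrite -T_laplace//; apply: eq_integral => w _.
by rewrite -discountE.
Qed.

Let integrable_discount z : 0 < z ->
  P.-integrable setT (fun w => (discount z (T w))%:E).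
Proof.
move=> z0; apply/integrableP; split.
  by apply/measurable_EFinP; exact: measurable_discount.
under eq_integral do rewrite /= ger0_norm ?discount_ge0//.
by rewrite integral_discount// ltry.
Qed.

(** Monotone convergence for (1 - e^(-z T)) / z. *)
Lemma mean_limit :
  ((1 - L (halving R n)) / halving R n)%:E @[n --> \oo] --> mean P T.
Proof.
pose g n w := ((1 - discount (halving R n) (T w)) / halving R n)%:E.
rewrite (_ : (fun n => _) = (fun n => \int[P]_w g n w)%E); last first.
  apply/funext => n; have z0 := halving_gt0 R n.
  rewrite /g; under eq_integral do rewrite EFinM EFinB.
  rewrite integralZr//; last first.
    by apply: integrableB => //;
      [exact: finite_measure_integrable_cst|exact: integrable_discount].
  rewrite integralB//; last 2 first.
  - exact: finite_measure_integrable_cst.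
  - exact: integrable_discount.
  by rewrite integral_cst_probability integral_discount.
rewrite /mean (_ : (\int[P]_w T w)%E = (\int[P]_w limn (g ^~ w))%E); last first.
  apply: eq_integral => w _; apply/esym/cvg_lim => //.
  apply: cvg_discount_quotient; [exact: halving_gt0|exact: cvg_halving|].
  exact: lt_le_trans (T_ge0 w).
apply: cvg_monotone_convergence => //.
- move=> n; apply/measurable_EFinP; apply: measurable_funM => //.
  by apply: measurable_funB => //; apply: measurable_discount;
    exact: halving_gt0.
- by move=> n w _; rewrite lee_fin discount_quotient_ge0// halving_gt0.
- move=> w _ m n mn; rewrite lee_fin.
  exact: (nondecreasing_discount_quotient (T_ge0 w) mn).
Qed.

(** Monotone convergence for the square of (1 - e^(-z T)) / z, which is
    (1 - 2 e^(-z T) + e^(-2 z T)) / z^2. *)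
Lemma mean_square_limit :
  ((1 - 2 * L (halving R n) + L (2 * halving R n)) / halving R n ^+ 2)%:E
    @[n --> \oo] --> (\int[P]_w (T w ^+ 2))%E.
Proof.
pose g n w := (((1 - discount (halving R n) (T w)) / halving R n) ^+ 2)%:E.
rewrite (_ : (fun n => _) = (fun n => \int[P]_w g n w)%E); last first.
  apply/funext => n; have z0 := halving_gt0 R n.
  have z20 : 0 < 2 * halving R n by rewrite mulr_gt0.
  rewrite /g; under eq_integral.
    move=> w _.
    rewrite (_ : (_ ^+ 2)%:E = (((1 - 2 * discount (halving R n) (T w)) +
       discount (2 * halving R n) (T w)) / halving R n ^+ 2)%:E); last first.
      by rewrite discount_double//; congr EFin; field; rewrite gt_eqF.
    rewrite EFinM EFinD EFinB EFinM.
    over.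
  have int2 : P.-integrable setT
    (fun w => 2%:E * (discount (halving R n) (T w))%:E)%E.
    by apply: integrableZl => //; exact: integrable_discount.
  have int3 : P.-integrable setT
    (fun w => 1 - 2%:E * (discount (halving R n) (T w))%:E)%E.
    by apply: integrableB => //; exact: finite_measure_integrable_cst.
  rewrite integralZr//; last by apply: integrableD => //;
    exact: integrable_discount.
  rewrite integralD//; last exact: integrable_discount.
  rewrite integralB//; last exact: finite_measure_integrable_cst.
  by rewrite integral_cst_probability integralZl// ?integral_discount//;
    exact: integrable_discount.
rewrite (_ : (\int[P]_w (T w ^+ 2))%E = (\int[P]_w limn (g ^~ w))%E);
  last first.
  apply: eq_integral => w _; apply/esym/cvg_lim => //.
  have c := cvg_discount_quotient (@halving_gt0 R) (@cvg_halving R)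
    (lt_le_trans (ltNyr 0) (T_ge0 w)).
  rewrite expe2 (_ : g ^~ w =
    (fun n => ((1 - discount (halving R n) (T w)) / halving R n)%:E *
    ((1 - discount (halving R n) (T w)) / halving R n)%:E)%E).
    apply: cvgeM => //; rewrite /mule_def.
    by case: (T w) => [r||]; rewrite //= ?andbF.
  by apply/funext => n; rewrite /g expr2 EFinM.
apply: cvg_monotone_convergence => //.
- move=> n; apply/measurable_EFinP; apply: measurable_funX => //.
  apply: measurable_funM => //.
  by apply: measurable_funB => //; apply: measurable_discount;
    exact: halving_gt0.
- by move=> n w _; rewrite lee_fin sqr_ge0.
- move=> w _ m n mn; rewrite lee_fin ler_sqr ?nnegrE.
  + exact: (nondecreasing_discount_quotient (T_ge0 w) mn).
  + by rewrite discount_quotient_ge0// halving_gt0.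
  + by rewrite discount_quotient_ge0// halving_gt0.
Qed.

(** The identity T^2 + m^2 = (T - m)^2 + 2 m T holds for T = +oo too and has
    nonnegative terms only, so it can be integrated without knowing beforehand
    that T is almost surely finite. *)
Lemma var_mean_square (m s : R) : 0 < m -> mean P T = m%:E ->
  (\int[P]_w (T w ^+ 2) = s%:E)%E -> var P T = (s - m ^+ 2)%:E.
Proof.
move=> m0 Tm Ts.
have mT2 : measurable_fun setT (fun w => (T w - m%:E) ^+ 2)%E.
  by apply: emeasurable_funM; exact: emeasurable_funB.
have Tm0 w : (0 <= (T w - m%:E) ^+ 2)%E by exact: sqre_ge0.
have : (\int[P]_w (T w ^+ 2 + (m ^+ 2)%:E) =
        \int[P]_w ((T w - m%:E) ^+ 2 + (2 * m)%:E * T w))%E.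
  apply: eq_integral => w _; have := T_ge0 w; case: (T w) => [r||]// _.
    by rewrite /=; congr EFin; ring.
  by rewrite !expe2 !mulyy/= gt0_muley// lte_fin mulr_gt0.
rewrite ge0_integralD//; last 3 first.
- by move=> w _; rewrite expe2 mule_ge0.
- by apply: emeasurable_funM.
- by move=> w _; rewrite lee_fin sqr_ge0.
rewrite ge0_integralD//; last 2 first.
- by move=> w _; rewrite mule_ge0// lee_fin mulr_ge0// ltW.
- exact: measurable_funeM.
rewrite ge0_integralZl_EFin//; last by rewrite mulr_ge0// ltW.
rewrite Ts.
move: Tm; rewrite /mean => Tm.
rewrite Tm integral_cst_probability -EFinM => /eqP; rewrite -sube_eq//;
  last by rewrite fin_num_adde_defl.
rewrite /var /mean Tm => /eqP <-.
by rewrite /=; congr EFin; ring.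
Qed.

End MomentLimits.

(** * The moments of the lossless time *)

Section PositivePart.
Context d (Omega : measurableType d) (R : realType) (P : probability Omega R).
Variables (X : {RV P >-> R}) (G : R -> R).

Definition pos_part (w : Omega) : R := Num.max (X w) 0.

Lemma measurable_pos_part : measurable_fun setT pos_part.
Proof. exact: measurable_maxr. Qed.

HB.instance Definition _ :=
  isMeasurableFun.Build _ _ _ _ pos_part measurable_pos_part.

(** A variable of law G that is nonnegative everywhere, and not only almost
    surely, as required for the pointwise limits near lambda. *)
Lemma pos_part_law : (forall t : R, P [set w | X w < t] = (G t)%:E) ->
  G t @[t --> 0^'+] --> 0 ->
  forall t : R, P [set w | pos_part w < t] = (G t)%:E.
Proof.
move=> X_law G0 t; have [t0|t0] := leP t 0; last first.
  rewrite -X_law; congr (P _); apply/seteqP; split => w /=;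
    by rewrite /pos_part gt_max t0 andbT.
rewrite (_ : [set w | _] = set0); last first.
  apply/seteqP; split => // w /=; rewrite /pos_part gt_max => /andP[_ t0'].
  by have := lt_le_trans t0' t0; rewrite ltxx.
rewrite measure0 -X_law; apply/eqP; rewrite eq_le measure_ge0/=.
rewrite -(probability_nonpos0 X_law G0); apply: le_measure; rewrite ?inE.
- by have := measurable_funPTI X (measurable_itv `]-oo, t[).
- by have := measurable_funPTI X (measurable_itv `]-oo, 0]).
- by move=> w /= Xt; rewrite ltW// (lt_le_trans Xt).
Qed.

End PositivePart.

Section Moments.
Context d (Omega : measurableType d) (R : realType) (P : probability Omega R).
Variables (tau eta : nat -> {RV P >-> R}) (lambda : R) (G : R -> R).
Hypotheses (lambda_gt0 : 0 < lambda)
    (tau_indep : mutually_independent tau)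
    (eta_indep : mutually_independent eta)
    (tau_eta_indep : independent_seqs tau eta)
    (tau_law : forall (k : nat) (t : R), 0 <= t ->
       P [set w | tau k w < t] = (1 - expR (- (lambda * t)))%:E)
    (eta_law : forall (k : nat) (t : R), P [set w | eta k w < t] = (G t)%:E)
    (G_right0 : G t @[t --> 0^'+] --> 0).
Local Notation T := (lossless_time tau eta).
Local Notation phi := (laplace_stieltjes G).
Local Notation intG :=
  (\int[lebesgue_measure]_(t in `[0, +oo[) (t * expR (- (lambda * t)) * G t)).

(** T is the pointwise limit of (1 - e^(-z T)) / z, and e^(-z T) is the sum of a
    series of measurable functions. *)
Lemma measurable_lossless_time : measurable_fun setT T.
Proof.
apply: (emeasurable_fun_cvg (fun n w =>
  ((1 - discount (halving R n) (T w)) / halving R n)%:E)) => [n|w _].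
  apply/measurable_EFinP; apply: measurable_funM => //.
  apply: measurable_funB => //.
  rewrite /discount; apply: measurableT_comp => //.
  by apply: measurable_discounted; exact: halving_gt0.
apply: cvg_discount_quotient; [exact: halving_gt0|exact: cvg_halving|].
by rewrite /lossless_time; case: first_loss => // n; rewrite ltNyr.
Qed.

Lemma ae_lossless_time_ge0 : {ae P, forall w, (0 <= T w)%E}.
Proof.
have : {ae P, forall w, forall k, 0 <= tau k w}.
  by apply: ae_foralln => k; exact: ae_exponential_ge0 (tau_law k).
apply: filterS => w tau0; rewrite /lossless_time.
by case: first_loss => // n; rewrite lee_fin sumr_ge0.
Qed.

(** T may be negative on a null set, where some tau_k is; T' is its version to
    which monotone convergence applies. *)
Let T' w := maxe (T w) 0%E.

Let T'_ge0 w : (0 <= T' w)%E. Proof. by rewrite /T' le_max lexx orbT. Qed.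

Let mT' : measurable_fun setT T'.
Proof. by apply: measurable_maxe => //; exact: measurable_lossless_time. Qed.

Let T'E : {ae P, forall w, T' w = T w}.
Proof. by apply: filterS ae_lossless_time_ge0 => w T0; rewrite /T' max_l. Qed.

Let D z := z + lambda * (1 - phi (z + lambda)).
Let L z := lambda * (1 - phi (z + lambda)) / D z.

Let D_gt0 z : 0 < z -> 0 < D z.
Proof.
move=> z0; rewrite /D ltr_pwDl// mulr_ge0 ?subr_ge0//; first exact: ltW.
by apply: (laplace_le1 (eta_law 0)) => //; rewrite ltW// addr_gt0.
Qed.

Let T'_laplace z : 0 < z ->
  (\int[P]_w expeR (- (z%:E * T' w)) = (L z)%:E)%E.
Proof.
move=> z0; rewrite -(laplace_lossless_time lambda_gt0 tau_indep eta_indep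
  tau_eta_indep tau_law eta_law G_right0 z0).
apply: ae_eq_integral => //.
- apply: (eq_measurable_fun (fun w => (discount z (T' w))%:E)).
    by move=> w _; rewrite discountE.
  apply/measurable_EFinP; exact: measurable_discount.
- exact: measurable_discounted.
- by apply: filterS T'E => w -> _.
Qed.

Let q_gt0 : 0 < 1 - phi lambda.
Proof. by rewrite subr_gt0; exact: (laplace_lt1 (eta_law 0)). Qed.

Let cvg_D (c : R) : 0 <= c ->
  D (c * halving R n) @[n --> \oo] --> lambda * (1 - phi lambda).
Proof.
move=> c0; rewrite /D -[X in _ --> X]add0r; apply: cvgD.
  by rewrite -[X in _ --> X](mulr0 c); apply: cvgM;
    [exact: cvg_cst|exact: cvg_halving].
apply: cvgM; first exact: cvg_cst.
apply: cvgB; first exact: cvg_cst.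
apply: (cvg_laplace (Y := pos_part (eta 0))) => //.
- exact: pos_part_law.
- by move=> w; rewrite /pos_part le_max lexx orbT.
- exact: halving_gt0.
- exact: cvg_halving.
Qed.

Let lq_neq0 : lambda * (1 - phi lambda) != 0.
Proof. by rewrite gt_eqF// mulr_gt0. Qed.

Lemma mean_lossless_time : mean P T = (1 / (lambda * (1 - phi lambda)))%:E.
Proof.
transitivity (mean P T').
  apply: ae_eq_integral => //; first exact: measurable_lossless_time.
  by apply: filterS T'E => w -> _.
have := mean_limit T'_ge0 mT' T'_laplace.
have cD : (1 / D (1 * halving R n))%:E @[n --> \oo] -->
  (1 / (lambda * (1 - phi lambda)))%:E.
  apply: cvg_EFin; first exact: nearW.
  apply: cvgM; first exact: cvg_cst.
  by apply: cvgV => //; exact: cvg_D.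
rewrite (_ : (fun n => _) = (fun n => (1 / D (1 * halving R n))%:E)).
  by move=> cm; exact: cvg_unique cm cD.
apply/funext => n; congr EFin; rewrite mul1r /L.
have z0 := halving_gt0 R n; have zN0 : halving R n != 0 by rewrite gt_eqF.
have DN0 : D (halving R n) != 0 by rewrite gt_eqF// D_gt0.
apply: (mulIf zN0); apply: (mulIf DN0).
rewrite divfK// mulrBl mul1r divfK// /D.
by field; exact: DN0.
Qed.

Lemma mean_square_lossless_time :
  (\int[P]_w (T' w ^+ 2) =
    (2 * (1 + lambda * (lambda * intG - phi lambda / lambda)) /
     (lambda * (1 - phi lambda)) ^+ 2)%:E)%E.
Proof.
have := mean_square_limit T'_ge0 mT' T'_laplace.
have Y0 w : 0 <= pos_part (eta 0) w by rewrite /pos_part le_max lexx orbT.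
have cphi := cvg_laplace_quotient lambda_gt0 (pos_part_law (eta_law 0) G_right0)
  G_right0 Y0 (@halving_gt0 R) (@cvg_halving R).
pose h n := 2 *
  (1 + lambda * ((phi (halving R n + lambda) - phi (2 * halving R n + lambda))
    / halving R n)) /
   (D (1 * halving R n) * D (2 * halving R n)).
have ch : (h n)%:E @[n --> \oo] -->
  (2 * (1 + lambda * (lambda * intG - phi lambda / lambda)) /
     (lambda * (1 - phi lambda)) ^+ 2)%:E.
  apply: cvg_EFin; first exact: nearW.
  apply: cvgM.
    apply: cvgM; first exact: cvg_cst.
    apply: cvgD; first exact: cvg_cst.
    by apply: cvgM; first exact: cvg_cst.
  apply: cvgV; first by rewrite expf_neq0.
  by rewrite expr2; apply: cvgM; exact: cvg_D.
rewrite (_ : (fun n => _) = (fun n => (h n)%:E)).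
  by move=> cm; exact: cvg_unique cm ch.
apply/funext => n; congr EFin; rewrite /h mul1r /L.
have z0 := halving_gt0 R n; have zN0 : halving R n != 0 by rewrite gt_eqF.
have DN0 : D (halving R n) != 0 by rewrite gt_eqF// D_gt0.
have DN0' : D (2 * halving R n) != 0 by rewrite gt_eqF// D_gt0// mulr_gt0.
move: DN0 DN0'; rewrite /D => DN0 DN0'.
by field; rewrite DN0' DN0.
Qed.

Lemma var_lossless_time :
  var P T = ((2 * (1 - phi lambda + lambda * (lambda * intG)) - 1) /
    (lambda ^+ 2 * (1 - phi lambda) ^+ 2))%:E.
Proof.
have mTT' : mean P T' = mean P T.
  apply: ae_eq_integral => //; first exact: measurable_lossless_time.
  by apply: filterS T'E => w -> _.
have -> : var P T = var P T'.
  rewrite /var mTT'; apply: ae_eq_integral => //.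
  - apply: emeasurable_funM; apply: emeasurable_funB => //;
      exact: measurable_lossless_time.
  - by apply: emeasurable_funM; exact: emeasurable_funB.
  - by apply: filterS T'E => w -> _.
rewrite mean_lossless_time in mTT'.
rewrite (var_mean_square T'_ge0 mT' _ mTT' mean_square_lossless_time);
  last first.
  by rewrite divr_gt0// mulr_gt0.
congr EFin; have lN0 : lambda != 0 by rewrite gt_eqF.
have qN0 : 1 - phi lambda != 0 by rewrite gt_eqF.
by field; rewrite lN0 qN0.
Qed.

End Moments.

Theorem mainTheorem5 (R : realType) (d : measure_display)
    (Omega : measurableType d) (P : probability Omega R)
    (tau eta : nat -> {RV P >-> R}) (lambda : R) (G : R -> R)
    (lambda_gt0 : 0 < lambda)
    (tau_indep : mutually_independent tau)
    (eta_indep : mutually_independent eta)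
    (tau_eta_indep : independent_seqs tau eta)
    (tau_law : forall (k : nat) (t : R), 0 <= t ->
       P [set w | tau k w < t] = (1 - expR (- (lambda * t)))%:E)
    (eta_law : forall (k : nat) (t : R), P [set w | eta k w < t] = (G t)%:E)
    (G_right0 : G t @[t --> 0^'+] --> 0) :
  let T := lossless_time tau eta in
  let phi := laplace_stieltjes G in
  let q := 1 - phi lambda in
  let a0 := lambda *
    \int[lebesgue_measure]_(t in `[0, +oo[) (t * expR (- (lambda * t)) * G t) in
  [/\ forall z : R, 0 <= z ->
        mean P (fun w => expeR (- (z%:E * T w))%E) =
        (lambda * (1 - phi (z + lambda)) /
          (z + lambda * (1 - phi (z + lambda))))%:E,
      mean P T = (1 / (lambda * q))%:E
    & var P T =
        ((2 * (q + lambda * a0) - 1) / (lambda ^+ 2 * q ^+ 2))%:E].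
Proof.
move=> T phi q a0; split.
(* At z = 0 the left-hand side is 1 because 0 * +oo = 0; on the right q > 0. *)
- move=> z; rewrite le_eqVlt => /predU1P[<-|z0];
    last exact: laplace_lossless_time.
  have lq0 : lambda * (1 - phi lambda) != 0.
    by rewrite mulf_neq0 ?gt_eqF// subr_gt0; exact: (laplace_lt1 (eta_law 0)).
  rewrite !add0r divff// /mean; under eq_integral do rewrite mul0e oppe0 expeR0.
  exact: integral_cst_probability.
- exact: mean_lossless_time.
- exact: var_lossless_time.
Qed.
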